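(* Let $n\equiv 1\pmod 4$ be a positive integer and let $a$ be an indeterminate. Then, modulo $[n]_{q^2}(1-aq^{2n})(a-q^{2n})$, \[ \sum_{k=0}^{(n-1)/4}[8k+1]_{q^2}[8k+1]^2\frac{(q^2;q^8)_k^2(aq^2;q^8)_k(q^2/a;q^8)_k}{(q^8;q^8)_k^2(aq^8;q^8)_k(q^8/a;q^8)_k}q^{-4k} \equiv [n]_{q^2}\frac{(q^4;q^8)_{(n-1)/4}}{(q^8;q^8)_{(n-1)/4}}q^{-(n-1)/2}\left(1-\frac{(1-aq^2)(1-q^2/a)}{(1-q)^2(1+q^2)}\right). \]
   Context: For an indeterminate $q$, $(x;q)_k=(1-x)(1-xq)\cdots(1-xq^{k-1})$ (with $(x;q)_0=1$). For an integer $m$, $[m]=(1-q^m)/(1-q)$ and $[m]_{q^2}=(1-q^{2m})/(1-q^2)$. A congruence $A\equiv B\pmod{P}$ between rational functions in $q$ and $a$ means that $A-B$, written as a quotient of polynomials with denominator coprime to $P$, has numerator divisible by $P$. *)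

(* Defs.v *)
From HB Require Import structures.
From mathcomp Require Import all_boot all_order all_algebra fraction.
Set Implicit Arguments. Unset Strict Implicit. Unset Printing Implicit Defensive.
Import Order.TTheory GRing.Theory Num.Theory.
Local Open Scope ring_scope.

(* Bivariate polynomials over Q: the outer variable is a, the inner one is q. *)
Definition Rqa := {poly {poly rat}}.
Definition Kqa := {fraction Rqa}.
Notation "x %:F" := (@FracField.tofrac Rqa x).

Definition qP : Rqa := ('X : {poly rat})%:P.
Definition aP : Rqa := 'X.
Definition qF : Kqa := qP%:F.
Definition aF : Kqa := aP%:F.

Definition pdvd (x y : Rqa) : Prop := exists c : Rqa, y = c * x.
Definition pcoprime (x y : Rqa) : Prop :=
  forall g : Rqa, pdvd g x -> pdvd g y -> g \is a GRing.unit.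

Definition congr_mod (A B : Kqa) (P : Rqa) : Prop :=
  exists N D : Rqa, D != 0 /\ A - B = N%:F / D%:F /\ pcoprime D P /\ pdvd P N.

Definition qpoch (x r : Kqa) (k : nat) : Kqa := \prod_(i < k) (1 - x * r ^+ i).

Definition qint (m : nat) : Kqa := (1 - qF ^+ m) / (1 - qF).
Definition qint2 (m : nat) : Kqa := (1 - qF ^+ (2 * m)) / (1 - qF ^+ 2).

Definition qint2P (m : nat) : Rqa := \sum_(i < m) qP ^+ (2 * i).

(* Main.v *)
Require Import Defs.
From HB Require Import structures.
From mathcomp Require Import all_boot all_order all_algebra all_field fraction.
From mathcomp Require Import ring zify.
Set Implicit Arguments. Unset Strict Implicit. Unset Printing Implicit Defensive.
Import Order.TTheory GRing.Theory Num.Theory.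
Local Open Scope ring_scope.

(** Write [n = 4M + 1], [s = q^2], [Q = q^8].  Divisibility of the difference of
    the two sides by the modulus is tested at points [(q, a)] with coordinates
    in the field [C(t)] ([C] the algebraic numbers): the points [(w, t)] with
    [w^(2n) = 1 <> w^2], which detect the squarefree polynomial [n]_{q^2}, and
    [(t, t^(2n))], [(t, t^(-2n))], which detect the two linear factors.

    At [a = q^(2n)] or [a = q^(-2n)] the sum terminates naturally.  Since
    [(1 - q X)^2 / X = X^-1 + s X - 2 q] for [X = Q^k], it splits into a
    terminating 6phi5 sum (evaluated by a WZ certificate in [M]) and a sum with
    the extra factor [X^-1 + s X], which differs from a multiple of the former
    by a telescoping sum.

    At [q = w] let [d] be the order of [w^2], and [m = M mod d], so that
    [d | 4m + 1].  In each block [l d <= k < (l + 1) d] the terms with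
    [k > l d + m] vanish and the reflection [k - l d -> m - (k - l d)] changes
    the sign of the others, so the sum is zero; so is the right-hand side.

    The quotients [(q^2;Q)_k / (Q;Q)_k] have no pole at the points [(w, t)], as
    each is a Gaussian binomial [M choose k]_Q times factors
    [(1 - s^(4i+1)) / (1 - s^(4(M-i)))], and [(4i + 1) + 4(M - i) = n]. *)

(** * Basic hypergeometric identities *)

Definition poch (F : fieldType) (x r : F) (k : nat) : F :=
  \prod_(i < k) (1 - x * r ^+ i).

Section Pochhammer.
Variable F : fieldType.
Implicit Types x r y : F.

Lemma poch0 x r : poch x r 0 = 1.
Proof. by rewrite /poch big_ord0. Qed.

Lemma pochS x r k : poch x r k.+1 = poch x r k * (1 - x * r ^+ k).
Proof. by rewrite /poch big_ord_recr. Qed.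

Lemma pochSl x r k : poch x r k.+1 = (1 - x) * poch (x * r) r k.
Proof.
rewrite /poch big_ord_recl expr0 mulr1; congr (_ * _).
by apply: eq_bigr => i _; rewrite lift0 exprS mulrA.
Qed.

Lemma poch_neq0 x r k :
  (forall i, (i < k)%N -> 1 - x * r ^+ i != 0) -> poch x r k != 0.
Proof. by move=> h; apply/prodf_neq0 => i _; apply: h. Qed.

(** Each factor is turned around by [1 - x * r^(-j) = - x * r^(-j) * (1 - r^j / x)]. This removes
    the negative power of [r] from the bases in the closed form of the 6phi5 sum. *)
Lemma poch_rev x r M : x != 0 -> r != 0 ->
  poch (x / r ^+ M) r M = x ^+ M * (\prod_(i < M) - r ^- i.+1) * poch (r / x) r M.
Proof.
move=> x0 r0; elim: M => [|M IH]; first by rewrite !poch0 big_ord0 !mulr1.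
have rM : r ^+ M != 0 by rewrite expf_neq0.
rewrite pochSl; have -> : x / r ^+ M.+1 * r = x / r ^+ M.
  by rewrite exprS; field; rewrite r0 rM.
rewrite IH big_ord_recr pochS !exprS /=.
by field; rewrite x0 r0 rM.
Qed.

End Pochhammer.

(** * The terminating very-well-poised 6phi5 summation *)

Section SixPhiFive.
Variables (F : fieldType) (a b c Q : F).
Hypotheses (b0 : b != 0) (c0 : c != 0).
Hypothesis a1 : 1 - a != 0.
Hypothesis Qk1 : forall k, 1 - Q * Q ^+ k != 0.
Hypothesis bk : forall k, b - a * Q * Q ^+ k != 0.
Hypothesis ck : forall k, c - a * Q * Q ^+ k != 0.

(** Equal to [y^k (1/y; Q)_k] for nonzero [y]. At [y = Q^M] it is the terminating parameter [Q^(-M)]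
    together with its share [y^k] of the argument, in polynomial form. *)
Definition qfall (y : F) (k : nat) : F := \prod_(i < k) (y - Q ^+ i).

Lemma qfallS y k : qfall y k.+1 = qfall y k * (y - Q ^+ k).
Proof. by rewrite /qfall big_ord_recr. Qed.

Lemma qfall_shift y k : qfall (y * Q) k.+1 = (y * Q - 1) * Q ^+ k * qfall y k.
Proof.
elim: k => [|k IH]; first by rewrite /qfall big_ord1 big_ord0 expr0 !mulr1.
rewrite qfallS IH qfallS !exprS; ring.
Qed.

(** At [y = Q^M] this is the summand of the very-well-poised 6phi5 with parameters [a; b, c, Q^(-M)]
    and argument [a Q^(M+1) / (b c)]. *)
Definition wp_term (y : F) (k : nat) : F :=
  (1 - a * Q ^+ k ^+ 2) / (1 - a) *
  (poch a Q k * poch b Q k * poch c Q k * qfall y k) /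
  (poch Q Q k * poch (a * Q / b) Q k * poch (a * Q / c) Q k
     * poch (a * Q * y) Q k) * (a * Q / (b * c)) ^+ k.

(* [y] stands for [Q ^+ M] and [y * Q] for [Q ^+ M.+1]; the right-hand side is
   the WZ certificate, which vanishes at [N = M.+1]. *)
Lemma six_phi_five_wz y N :
  b - a * Q * y != 0 -> c - a * Q * y != 0 ->
  (forall k, 1 - a * Q * y * Q ^+ k != 0) ->
  \sum_(k < N.+1) (wp_term (y * Q) k
    - (1 - a * Q * y) * (b * c - a * Q * y) / ((b - a * Q * y) * (c - a * Q * y))
      * wp_term y k) * (b - a * Q * y) * (c - a * Q * y) =
  y * b * c * (1 - a * Q * y) / (1 - a) *
  (poch a Q N.+1 * poch b Q N.+1 * poch c Q N.+1 * qfall y N) /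
  (poch Q Q N * poch (a * Q / b) Q N * poch (a * Q / c) Q N
     * poch (a * Q * y) Q N.+1) * (a * Q / (b * c)) ^+ N.+1.
Proof.
move=> hb hc hy.
have hbk k : 1 - a * Q / b * Q ^+ k != 0.
  have -> : 1 - a * Q / b * Q ^+ k = (b - a * Q * Q ^+ k) / b by field.
  by rewrite mulf_neq0 ?bk ?invr_neq0.
have hck k : 1 - a * Q / c * Q ^+ k != 0.
  have -> : 1 - a * Q / c * Q ^+ k = (c - a * Q * Q ^+ k) / c by field.
  by rewrite mulf_neq0 ?ck ?invr_neq0.
have pQ k : poch Q Q k != 0 by apply: poch_neq0 => i _.
have pb k : poch (a * Q / b) Q k != 0 by apply: poch_neq0 => i _.
have pc k : poch (a * Q / c) Q k != 0 by apply: poch_neq0 => i _.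
have py k : poch (a * Q * y) Q k != 0 by apply: poch_neq0 => i _.
have y0 := hy 0%N; rewrite expr0 mulr1 in y0.
have yk := hy.
(* Expresses the denominator at [y * Q] through the one at [y], so that both kinds of terms share
   their factors. *)
have pyQ k : poch (a * Q * (y * Q)) Q k = poch (a * Q * y) Q k.+1 / (1 - a * Q * y).
  by rewrite pochSl mulrA; field.
elim: N => [|N IH].
  rewrite big_ord1 /wp_term /qfall !big_ord0 !pochS !poch0 !expr0 expr1.
  by field; rewrite hb hc b0 c0 a1 y0 oner_neq0.
rewrite big_ord_recr /= IH {IH}.
rewrite /wp_term qfall_shift pyQ !pochS !qfallS (exprS _ N.+1) [Q ^+ N.+1]exprS.
set X := Q ^+ N; set Z := (a * Q / (b * c)) ^+ N.+1.
have := yk N.+1; have := hbk N; have := hck N; have := yk N; have := Qk1 N.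
have := bk N; have := ck N.
rewrite [Q ^+ N.+1]exprS -/X.
move=> h1 h2 h3 h4 h5 h6 h7.
have := py N; have := pc N; have := pb N; have := pQ N.
move: (poch a Q N) (poch b Q N) (poch c Q N) (poch Q Q N) (poch (a * Q / b) Q N) (poch
  (a * Q / c) Q N) (poch (a * Q * y) Q N) (qfall y N) =>
  A B C D E G H I g1 g2 g3 g4.
by field; rewrite b0 c0 a1 hb hc y0 g1 g2 g3 g4 h1 h2 h3 h4 h7.
Qed.

Hypothesis ak : forall k, 1 - a * Q * Q ^+ k != 0.

Lemma qfall_pow_eq0 M k : (M < k)%N -> qfall (Q ^+ M) k = 0.
Proof. by move=> lt; rewrite /qfall (bigD1 (Ordinal lt)) //= subrr mul0r. Qed.

(** Induction on [M]. Summed up to [N = M.+1], the certificate contains [qfall (Q ^+ M) M.+1 = 0],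
    so consecutive sums have the same ratio as consecutive closed forms. *)
Lemma six_phi_five M :
  \sum_(k < M.+1) wp_term (Q ^+ M) k =
  poch (a * Q) Q M * poch (a * Q / (b * c)) Q M /
    (poch (a * Q / b) Q M * poch (a * Q / c) Q M).
Proof.
elim: M => [|M IH].
  rewrite big_ord1 /wp_term /qfall !big_ord0 !poch0 !expr0.
  by field; rewrite a1 oner_neq0.
have hb := bk M; have hc := ck M.
have hy k : 1 - a * Q * Q ^+ M * Q ^+ k != 0 by rewrite -mulrA -exprD.
have := six_phi_five_wz M.+1 hb hc hy.
rewrite (qfall_pow_eq0 (ltnSn M)) !(mulr0, mul0r) -!mulr_suml -exprSr sumrB -mulr_sumr.
(* The sum for [M] stops one index earlier than the sum for [M.+1]; its additional term is zero. *)
have last0 : wp_term (Q ^+ M) M.+1 = 0.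
  by rewrite /wp_term (qfall_pow_eq0 (ltnSn M)) !(mulr0, mul0r).
rewrite [X in _ - _ * X]big_ord_recr /= last0 addr0 IH => /eqP.
rewrite !mulf_eq0 (negPf hb) (negPf hc) !orbF subr_eq0 => /eqP ->.
have pb : poch (a * Q / b) Q M != 0.
  apply: poch_neq0 => i _; have -> : 1 - a * Q / b * Q ^+ i = (b - a * Q * Q ^+ i) / b by field.
  by rewrite mulf_neq0 ?bk ?invr_neq0.
have pc : poch (a * Q / c) Q M != 0.
  apply: poch_neq0 => i _; have -> : 1 - a * Q / c * Q ^+ i = (c - a * Q * Q ^+ i) / c by field.
  by rewrite mulf_neq0 ?ck ?invr_neq0.
rewrite !pochS; move: pb pc hb hc.
move: (poch _ _ _) (poch _ _ _) (poch _ _ _) (poch _ _ _) (Q ^+ M) => A B C D X g1 g2 h1 h2.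
by field; rewrite b0 c0 g1 g2 h1 h2.
Qed.

End SixPhiFive.

(** * The telescoping companion of the 6phi5 sum *)

Section Telescoping.
Variables (F : fieldType) (s Q al : F).
Hypotheses (s0 : s != 0) (Q0 : Q != 0) (al0 : al != 0) (s1 : 1 - s != 0).
Hypothesis Qk : forall k, 1 - Q * Q ^+ k != 0.
Hypothesis alk : forall k, 1 - al * Q * Q ^+ k != 0.
Hypothesis alVk : forall k, al - Q * Q ^+ k != 0.

(** The very-well-poised 6phi5 summand with base parameter [s] and numerator parameters [s],
    [al * s] and [s / al]. *)
Definition bal_term (k : nat) : F :=
  (1 - s * Q ^+ k ^+ 2) / (1 - s) *
  (poch s Q k ^+ 2 * poch (al * s) Q k * poch (s / al) Q k) /
  (poch Q Q k ^+ 2 * poch (al * Q) Q k * poch (Q / al) Q k) * (Q / s ^+ 2) ^+ k.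

(* Indefinitely summable because the argument [Q / s ^+ 2] of the series makes
   the difference of the two products of four factors antisymmetric under
   [Q ^+ k -> (s * Q ^+ k)^-1]. *)
Lemma bal_telescope N :
  \sum_(k < N.+1) bal_term k *
     ((1 + s^-1) * (Q ^- k + s * Q ^+ k) - (2 + al + al^-1)) =
  s / (1 - s) ^+ 2 *
  (poch s Q N.+1 ^+ 2 * poch (al * s) Q N.+1 * poch (s / al) Q N.+1) /
  (poch Q Q N ^+ 2 * poch (al * Q) Q N * poch (Q / al) Q N) / s ^+ 2 ^+ N.+1.
Proof.
elim: N => [|N IH].
  rewrite big_ord1 /bal_term !pochS !poch0 !expr0 expr1.
  by field; rewrite s0 al0 s1 oner_neq0.
have pQ : poch Q Q N != 0 by apply: poch_neq0 => i _.
have pal : poch (al * Q) Q N != 0 by apply: poch_neq0 => i _.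
have palV : poch (Q / al) Q N != 0.
  apply: poch_neq0 => i _; have -> : 1 - Q / al * Q ^+ i = (al - Q * Q ^+ i) / al by field.
  by rewrite mulf_neq0 ?invr_neq0.
rewrite big_ord_recr /= IH {IH} /bal_term expr_div_n [s ^+ 2 ^+ N.+2]exprS.
rewrite !pochS [Q ^+ N.+1]exprS.
have s20 : s ^+ 2 ^+ N.+1 != 0 by rewrite !expf_neq0.
have X0 : Q ^+ N != 0 by rewrite expf_neq0.
move: (Qk N) (alk N) (alVk N) pQ pal palV s20 X0.
move: (poch s _ _) (poch (al * s) _ _) (poch (s / al) _ _) (poch Q _ _) (poch
  (al * Q) _ _) (poch (Q / al) _ _) (s ^+ 2 ^+ N.+1) (Q ^+ N) =>
  A B C D E G Y X h1 h2 h3 h4 h5 h6 h7 h8.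
by field; rewrite s0 al0 s1 Q0 h1 h2 h3 h4 h5 h6 h7 h8.
Qed.

End Telescoping.

(** * Evaluation of the sum at [a = q^(2n)] *)

Section Specialization.
Variable F : fieldType.

(* [b] and [d] below stand for the quotients of [q]-factorials free of [a], which
   must be represented without poles before they are evaluated. *)
Definition lhs_term (u v b : F) (k : nat) : F :=
  (1 - u ^+ (2 * (8 * k + 1))) / (1 - u ^+ 2) *
  ((1 - u ^+ (8 * k + 1)) / (1 - u)) ^+ 2 *
  (b ^+ 2 * (poch (v * u ^+ 2) (u ^+ 8) k * poch (u ^+ 2 / v) (u ^+ 8) k) /
     (poch (v * u ^+ 8) (u ^+ 8) k * poch (u ^+ 8 / v) (u ^+ 8) k)) *
  u ^- (4 * k).

Definition rhs (u v d : F) (M : nat) : F :=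
  (1 - u ^+ (2 * (4 * M + 1))) / (1 - u ^+ 2) * d * u ^- (2 * M) *
  (1 - (1 - v * u ^+ 2) * (1 - u ^+ 2 / v) / ((1 - u) ^+ 2 * (1 + u ^+ 2))).

(** Together with [rhsV], reduces the point [a = q^(-2n)] to [a = q^(2n)]. *)
Lemma lhs_termV u v b k : lhs_term u v^-1 b k = lhs_term u v b k.
Proof.
rewrite /lhs_term invrK ![v^-1 * _]mulrC ![_ * v]mulrC.
by congr (_ * (_ * _ / _) * _); exact: mulrC.
Qed.

Lemma rhsV u v d M : rhs u v^-1 d M = rhs u v d M.
Proof.
rewrite /rhs invrK ![v^-1 * _]mulrC ![_ * v]mulrC.
by congr (_ * (1 - _ / _)); exact: mulrC.
Qed.

Variables (u : F) (M : nat).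
Hypotheses (u0 : u != 0) (uN1 : forall j, 1 - u ^+ j.+1 != 0).

Let s := u ^+ 2.
Let Q := u ^+ 8.
(** This is [u^(2n)] for [n = 4M + 1], so that [s / al = Q^(-M)] and the series terminates at
    [k = M]. *)
Let al := u ^+ (8 * M + 2).

Let uN j : (0 < j)%N -> 1 - u ^+ j != 0.
Proof. by case: j => // j _. Qed.

Let uNN i j : i != j -> u ^+ i - u ^+ j != 0.
Proof.
wlog lt : i j / (i < j)%N.
  move=> H; rewrite neq_ltn => /orP[] lt; first by apply: H => //; lia.
  by rewrite -opprB oppr_eq0; apply: H => //; lia.
move=> _; have -> : u ^+ i - u ^+ j = u ^+ i * (1 - u ^+ (j - i)).
  by rewrite mulrBr mulr1 -exprD subnKC // ltnW.
by rewrite mulf_neq0 ?expf_neq0 // uN // subn_gt0.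
Qed.

(** This is [six_phi_five] with [a = b = s] and [c = s * al]. Reversing the two products that
    involve [Q^(-M)] gives [(u^4; Q)_M / (s; Q)_M] and the power [s^(-M)], while
    [(s Q; Q)_M / (s; Q)_M] leaves [(1 - s Q^M) / (1 - s)]. *)
Lemma sum_bal_term :
  \sum_(k < M.+1) bal_term s Q al k =
  (1 - u ^+ (2 * (4 * M + 1))) / (1 - u ^+ 2) *
  (poch (u ^+ 4) Q M / poch Q Q M) * u ^- (2 * M).
Proof.
have al0 : al != 0 by rewrite expf_neq0.
have s0 : s != 0 by rewrite expf_neq0.
have Q0 : Q != 0 by rewrite expf_neq0.
have e1 : forall k : nat, 1 - Q * Q ^+ k != 0.
  by move=> k; rewrite /Q -exprM -exprD uN.
have e2 : forall k : nat, s - s * Q * Q ^+ k != 0.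
  by move=> k; rewrite /s /Q -exprM -!exprD uNN //; lia.
have e3 : forall k : nat, s * al - s * Q * Q ^+ k != 0.
  by move=> k; rewrite /s /al /Q -exprM -!exprD uNN //; lia.
have e4 : forall k : nat, 1 - s * Q * Q ^+ k != 0.
  by move=> k; rewrite /s /Q -exprM -!exprD uN.
have := six_phi_five s0 (mulf_neq0 s0 al0) (uN1 1) e1 e2 e3 e4 M.
have pQ k : poch Q Q k != 0 by apply: poch_neq0 => i _.
have pal k : poch (al * Q) Q k != 0.
  by apply: poch_neq0 => i _; rewrite /al /Q -exprM -!exprD uN // -addnA addn_gt0 orbC.
have palV k : poch (Q / al) Q k != 0.
  apply: poch_neq0 => i _; have -> : 1 - Q / al * Q ^+ i = (al - Q * Q ^+ i) / al by field.
  by rewrite mulf_neq0 ?invr_neq0 // /al /Q -exprM -!exprD uNN //; lia.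
set y := Q ^+ M.
have y0 : y != 0 by rewrite expf_neq0.
have alE : al = s * y by rewrite /al /y /s /Q -exprM -exprD addnC.
have s20 : s ^+ 2 != 0 by rewrite expf_neq0.
have -> : \sum_(k < M.+1) wp_term s s (s * al) Q y k =
   \sum_(k < M.+1) bal_term s Q al k.
  apply: eq_bigr => k _; rewrite /wp_term /bal_term.
  (* Since [s / al = y^-1], the parameter [s / al] is the terminating one. *)
  have -> : poch (s / al) Q k = qfall Q y k / y ^+ k.
    elim: (nat_of_ord k) => [|i IH].
      by rewrite poch0 /qfall big_ord0 expr0 divr1.
    have yi : y ^+ i != 0 by rewrite expf_neq0.
    by rewrite pochS qfallS IH exprS alE; field; rewrite y0 s0 yi.
  have -> : s * Q / s = Q by field.
  have -> : s * Q / (s * al) = Q / al by field; rewrite s0 al0.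
  have -> : s * Q * y = al * Q by rewrite alE; ring.
  have -> : s * Q / (s * (s * al)) = Q / s ^+ 2 / y.
    by rewrite alE; field; rewrite s0 y0.
  have yk : y ^+ k != 0 by rewrite expf_neq0.
  rewrite [(_ / y) ^+ k]expr_div_n [s * al]mulrC.
  move: (pQ k) (pal k) (palV k) yk => h1 h2 h3 h4.
  by field; rewrite h1 h2 h3 h4 (uN1 1).
have -> : s * Q / s = Q by field.
have -> : s * Q / (s * al) = Q / s / y by rewrite alE; field; rewrite s0 y0.
have -> : s * Q / (s * (s * al)) = Q / s ^+ 2 / y.
  by rewrite alE; field; rewrite s0 y0.
rewrite !poch_rev ?mulf_neq0 ?invr_neq0 // => ->.
have -> : Q / (Q / s) = s by field; rewrite Q0 s0.
have -> : Q / (Q / s ^+ 2) = u ^+ 4 by rewrite /s; field; rewrite Q0 u0.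
have ps k : poch s Q k != 0.
  by apply: poch_neq0 => i _; rewrite /s /Q -exprM -exprD uN.
have -> : poch (s * Q) Q M = (1 - s * y) / (1 - s) * poch s Q M.
  have := pochSl s Q M; rewrite pochS -/y => h.
  have s1 : 1 - s != 0 := uN1 1.
  by rewrite -[LHS](mulKf s1) -h; field.
have -> : s * y = u ^+ (2 * (4 * M + 1)).
  by rewrite /s /y /Q -exprM -exprD; congr (_ ^+ _); lia.
have -> : (Q / s ^+ 2) ^+ M = (Q / s) ^+ M / s ^+ M.
  by rewrite -expr_div_n; congr (_ ^+ _); field.
rewrite [u ^+ (2 * M)]exprM -/s.
have : \prod_(i < M) - Q ^- i.+1 != 0.
  by apply/prodf_neq0 => i _; rewrite oppr_eq0 invr_eq0 expf_neq0.
have : (Q / s) ^+ M != 0 by rewrite expf_neq0 // mulf_neq0 ?invr_neq0.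
have : s ^+ M != 0 by rewrite expf_neq0.
have : 1 - s != 0 := uN1 1.
move: (ps M) (pQ M).
move: (poch _ _ _) (poch _ _ _) (poch _ _ _) (s ^+ M) (_ ^+ M) (\prod_(i < M) _) =>
  A B C D E G h1 h2 h3 h4 h5 h6.
by field; rewrite h1 h2 h3 h4 h5 h6.
Qed.

Lemma sum_lhs_term :
  \sum_(k < M.+1) lhs_term u al (poch s Q k / poch Q Q k) k =
  rhs u al (poch (u ^+ 4) Q M / poch Q Q M) M.
Proof.
have al0 : al != 0 by rewrite expf_neq0.
have s0 : s != 0 by rewrite expf_neq0.
have Q0 : Q != 0 by rewrite expf_neq0.
have s1 : 1 - s != 0 := uN1 1.
have u1 : 1 - u != 0 by have := uN1 0.
have sp1 : 1 + s != 0.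
  have : 1 - u ^+ 4 != 0 := uN1 3.
  have -> : 1 - u ^+ 4 = (1 - s) * (1 + s) by rewrite /s; ring.
  by rewrite mulf_eq0 negb_or => /andP[].
have Qk k : 1 - Q * Q ^+ k != 0 by rewrite /Q -exprM -exprD uN.
have alk k : 1 - al * Q * Q ^+ k != 0.
  by rewrite /al /Q -exprM -!exprD uN // -addnA addn_gt0 orbC.
have alVk k : al - Q * Q ^+ k != 0.
  by rewrite /al /Q -exprM -!exprD uNN //; lia.
have tel := bal_telescope s0 Q0 al0 s1 Qk alk alVk M.
(* The factor of index [M] is [1 - (s / al) * Q^M = 0], so the boundary term of the telescoping sum
   vanishes. *)
have top0 : poch (s / al) Q M.+1 = 0.
  rewrite pochS; have -> : s / al * Q ^+ M = 1; last by rewrite subrr mulr0.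
  apply: (mulIf al0); rewrite mul1r mulrAC mulfVK //.
  by rewrite /s /al /Q -exprM -exprD addnC.
rewrite top0 !(mulr0, mul0r) in tel.
(* With [X = Q^k], [(1 - u X)^2 = X (X^-1 + s X - 2 u)], and [X * u^(-4k) = (Q / s^2)^k] is the
   argument of [bal_term]. Adding and subtracting [2 + al + al^-1] isolates the summand that
   telescopes. *)
have termE k : lhs_term u al (poch s Q k / poch Q Q k) k =
    (1 + s^-1)^-1 / (1 - u) ^+ 2 *
      (bal_term s Q al k * ((1 + s^-1) * (Q ^- k + s * Q ^+ k) - (2 + al + al^-1)))
    + ((1 + s^-1)^-1 * (2 + al + al^-1) - 2 * u) / (1 - u) ^+ 2 * bal_term s Q al k.
  rewrite /lhs_term /bal_term -/s -/Q expr_div_n.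
  have pQ : poch Q Q k != 0 by apply: poch_neq0 => i _.
  have pal : poch (al * Q) Q k != 0 by apply: poch_neq0 => i _.
  have palV : poch (Q / al) Q k != 0.
    apply: poch_neq0 => i _; have -> : 1 - Q / al * Q ^+ i = (al - Q * Q ^+ i) / al by field.
    by rewrite mulf_neq0 ?invr_neq0.
  have -> : u ^+ (2 * (8 * k + 1)) = s * Q ^+ k ^+ 2.
    by rewrite /s /Q -!exprM -exprD; congr (_ ^+ _); lia.
  have -> : u ^+ (8 * k + 1) = u * Q ^+ k by rewrite addn1 exprS exprM.
  have -> : (Q / s ^+ 2) ^+ k = u ^+ (4 * k).
    have -> : Q / s ^+ 2 = u ^+ 4 by rewrite /Q /s; field.
    by rewrite exprM.
  have QE : Q ^+ k = u ^+ (4 * k) ^+ 2.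
    by rewrite /Q -!exprM; congr (_ ^+ _); lia.
  rewrite QE.
  have : u ^+ (4 * k) != 0 by rewrite expf_neq0.
  have ssp1 : s + 1 != 0 by rewrite addrC.
  have sE : s = u ^+ 2 by [].
  move: pQ pal palV.
  move: (poch s _ _) (poch (al * s) _ _) (poch (s / al) _ _) (poch Q _ _)
    (poch (al * Q) _ _) (poch (Q / al) _ _)
    (u ^+ (4 * k)) => A B C D E G Y h1 h2 h3 h4.
  move: al0 s1 u1 sp1 ssp1; rewrite -/s sE; move: al => al' g1 g2 g3 g4 g5.
  clear - h1 h2 h3 h4 g1 g2 g3 g4 g5 u0.
  by field; rewrite h1 h2 h3 h4 g1 g2 g3 g5 u0.
under eq_bigr => k _ do rewrite termE.
rewrite big_split /= -!mulr_sumr tel mulr0 add0r.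
rewrite sum_bal_term /rhs -/s -/Q.
move: (_ / _ * (_ / _) * _ ^- _) => S.
move: al0 s1 u1 sp1; rewrite -/s; move: al => al' g1 g2 g3 g4.
have g5 : s + 1 != 0 by rewrite addrC.
rewrite /s in s0 g2 g4 g5 *.
(* The coefficient left in front of the 6phi5 sum is the last factor of [rhs]. *)
by field; rewrite g4 ?g1 ?g3 ?g5 ?u0.
Qed.

End Specialization.

(** * Vanishing at roots of unity *)

Section PochhammerReflection.
Variables (F : fieldType) (z Z y : F) (m : nat).
Hypotheses (zZ : z * Z ^+ m = 1) (y0 : y != 0).
Hypothesis yk : forall k, (0 < k <= m)%N -> 1 - y * Z ^+ k != 0.
Hypothesis yVk : forall k, (0 < k <= m)%N -> 1 - y^-1 * Z ^+ k != 0.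

Let z0 : z != 0.
Proof. by apply: contra_eq_neq zZ => ->; rewrite mul0r eq_sym oner_eq0. Qed.

(** Induction on [k]. Passing to [k.+1] removes the last factors on the left; by [z Z^m = 1] their
    quotient is expressed in [Z^k] and supplies one new factor of the quotient on the right, with
    one factor [Z / z]. *)
Lemma poch_reflect k : (k <= m)%N ->
  poch (y * z) Z (m - k) / poch (y * Z) Z (m - k) =
  poch (y * z) Z m / poch (y * Z) Z m * (Z / z) ^+ k *
  (poch (z / y) Z k / poch (Z / y) Z k).
Proof.
elim: k => [|k IH] km; first by rewrite subn0 !poch0 expr0 divr1 !mulr1.
have {}IH := IH (ltnW km).
have Z0 : Z != 0.
  apply: contra_eq_neq zZ => ->; case: (m) km => // m' _.
  by rewrite expr0n mulr0 eq_sym oner_eq0.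
have em : (m - k = (m - k.+1).+1)%N by lia.
rewrite em !pochS in IH.
have Zmk : Z ^+ (m - k.+1) = (z * Z ^+ k.+1)^-1.
  apply: (mulIf (mulf_neq0 z0 (expf_neq0 k.+1 Z0))).
  by rewrite mulVf ?mulf_neq0 ?expf_neq0 // mulrCA -exprD subnK.
have h1 : 1 - y * Z ^+ (m - k) != 0 by apply: yk; lia.
have h2 : 1 - y^-1 * Z ^+ k.+1 != 0 by apply: yVk; lia.
have p1 : poch (y * Z) Z (m - k.+1) != 0.
  by apply: poch_neq0 => i im; rewrite -mulrA -exprS yk //; lia.
have p2 : poch (Z / y) Z k != 0.
  by apply: poch_neq0 => i im; rewrite mulrAC -exprS mulrC yVk //; lia.
have p3 : poch (y * Z) Z m != 0.
  by apply: poch_neq0 => i im; rewrite -mulrA -exprS yk //; lia.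
move: IH h1 h2; rewrite em !pochS [Z ^+ (m - k.+1).+1]exprS Zmk !exprS.
have X0 : Z ^+ k != 0 by rewrite expf_neq0.
move: p1 p2 p3 X0 (Z0) ((Z / z) ^+ k).
move: (Z ^+ k) (poch _ _ _) (poch _ _ _) (poch _ _ _) (poch _ _ _) (poch _ _ _)
  (poch _ _ _) =>
  X A B C D E G p1 p2 p3 X0 Z0' Y IH h1 h2.
have g1 : y - Z * X != 0.
  have -> : y - Z * X = y * (1 - y^-1 * (Z * X)) by field.
  by rewrite mulf_neq0.
have g2 : z * X - y != 0.
  have -> : z * X - y = z * X * (1 - y * (Z / (z * (Z * X)))).
    by field; rewrite z0 Z0 X0.
  by rewrite !mulf_neq0.
have g3 : Z * X - y != 0 by rewrite -opprB oppr_eq0.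
have -> : C / G = B / D * Y * (A / E) * ((1 - y / (z * X)) / (1 - y / (Z * X))).
  by rewrite -IH; field; rewrite ?p1 ?p2 ?p3 ?X0 ?Z0 ?z0 ?g1 ?g2 ?g3.
by field; rewrite ?p1 ?p2 ?p3 ?X0 ?Z0 ?z0 ?y0 ?g1 ?g2 ?g3.
Qed.

End PochhammerReflection.

(** * Antisymmetry within blocks at a root of unity *)

Section RootOfUnity.
Variables (F : fieldType) (u v : F) (d m : nat).
Let z := u ^+ 2.
Let Z := u ^+ 8.
Hypotheses (char2 : (2 : F) != 0) (u1 : 1 - u != 0) (v0 : v != 0).
Hypotheses (d0 : (0 < d)%N) (zd : z ^+ d = 1) (zm : z * Z ^+ m = 1).
Hypothesis ZN1 : forall k, (0 < k < d)%N -> 1 - Z ^+ k != 0.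
Hypothesis vk : forall k, 1 - v * Z ^+ k != 0.
Hypothesis vVk : forall k, 1 - v^-1 * Z ^+ k != 0.
Hypothesis md : (m < d)%N.

Let z0 : z != 0.
Proof. by apply: contra_eq_neq zm => ->; rewrite mul0r eq_sym oner_eq0. Qed.

Let u0 : u != 0.
Proof. by move: z0; rewrite /z expf_eq0. Qed.

Let Zd l : Z ^+ (l * d) = 1.
Proof.
have -> : Z = z ^+ 4 by rewrite /z /Z -exprM.
have -> : z ^+ 4 ^+ (l * d) = z ^+ d ^+ (4 * l) by rewrite -!exprM; congr (_ ^+ _); lia.
by rewrite zd expr1n.
Qed.

Definition base_term (k : nat) : F := lhs_term u v (poch z Z k / poch Z Z k) k.

Lemma base_term_eq0 k : (m < k)%N -> base_term k = 0.
Proof.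
move=> mk; rewrite /base_term /lhs_term.
suff -> : poch z Z k = 0 by rewrite mul0r expr0n !(mul0r, mulr0).
by rewrite /poch (bigD1 (Ordinal mk)) //= zm subrr mul0r.
Qed.

(** Here [u^(8(m-k)+1) = u^(-(8k+1))], so the factor [1 - u^(2(8k+1))] yields the sign and the
    squared factor only a power of [u]. The Pochhammer quotients are reflected with [y = 1], [v] and
    [v^-1], and all remaining powers cancel. *)
Lemma base_term_anti k : (k <= m)%N -> base_term (m - k) = - base_term k.
Proof.
move=> km.
have Z0 : Z != 0 by rewrite expf_neq0.
have ZN1' : forall k, (0 < k <= m)%N -> 1 - 1 * Z ^+ k != 0.
  by move=> i /andP[i0 im]; rewrite mul1r ZN1 // i0 (leq_ltn_trans im).
have ZN1V : forall k, (0 < k <= m)%N -> 1 - 1^-1 * Z ^+ k != 0.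
  by rewrite invr1.
have R1 := poch_reflect zm (oner_neq0 _) ZN1' ZN1V.
have Rv := poch_reflect zm v0 (fun k _ => vk k) (fun k _ => vVk k).
have vVk' : forall k, 1 - v^-1^-1 * Z ^+ k != 0 by rewrite invrK.
have RV := poch_reflect zm (invr_neq0 v0) (fun k _ => vVk k) (fun k _ => vVk' k).
rewrite !invrK !(mulrC v^-1) in RV.
rewrite !invr1 !mul1r !mulr1 in R1.
(* Reflection at [k = m] has left-hand side 1 and so gives relations between the unknown constants
   of the reflection. *)
have c1 := R1 _ (leqnn m); have cv := Rv _ (leqnn m).
rewrite subnn !poch0 !divr1 in c1 cv.
rewrite /base_term /lhs_term -/z -/Z.
have splitE (x a b c e : F) : x * (a * b) / (c * e) = x * (a / c * (b / e)).
  by rewrite invfM -mulrA mulrACA.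
rewrite 2!splitE R1 // Rv // RV // [z * v]mulrC [Z * v]mulrC.
have Zz j : (Z / z) ^+ j = z ^+ j ^+ 3.
  have -> : Z / z = z ^+ 3 by rewrite /z /Z; field.
  by rewrite exprAC.
have mu4 : z * z ^+ m ^+ 4 = 1.
  by rewrite -[RHS]zm /Z /z -!exprM; congr (_ * _ ^+ _); lia.
have mu8 : z ^+ m ^+ 8 = z ^- 2.
  have -> : z ^+ m ^+ 8 = (z * z ^+ m ^+ 4) ^+ 2 / z ^+ 2 by field.
  by rewrite mu4 expr1n mul1r.
have U0 : z ^+ k != 0 by rewrite expf_neq0.
have M0 : z ^+ m != 0 by rewrite expf_neq0.
have e1 : u ^+ (8 * (m - k) + 1) = (u * z ^+ k ^+ 4)^-1.
  apply: (mulIf (mulf_neq0 u0 (expf_neq0 4 U0))); rewrite mulVf ?mulf_neq0 ?expf_neq0 //.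
  rewrite -[RHS]zm mulrA -exprSr /z /Z -!exprM -!exprD.
  by congr (_ ^+ _); lia.
have e2 : u ^+ (8 * k + 1) = u * z ^+ k ^+ 4.
  by rewrite /z -!exprM -exprS; congr (_ ^+ _); lia.
have e3 : u ^+ (4 * (m - k)) = (z ^+ m / z ^+ k) ^+ 2.
  by rewrite -exprB ?unitfE // /z -!exprM; congr (_ ^+ _); lia.
have e4 : u ^+ (4 * k) = z ^+ k ^+ 2.
  by rewrite /z -!exprM; congr (_ ^+ _); lia.
have e5 j : u ^+ (2 * j) = u ^+ j ^+ 2 by rewrite mulnC exprM.
rewrite !e5 !Zz e1 e2 e3 e4 in c1 cv *.
move: U0 M0 mu8 c1 cv.
move: (z ^+ k) (z ^+ m) (poch z Z m / _) (poch (v * z) Z m / _) (poch (z / v) Z m / _).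
move: (poch z Z k / _) (poch (v * z) Z k / _) (poch (z / v) Z k / _).
move=> b p q U mu B P P' U0 M0 mu8 c1 cv.
set W := RHS.
(* Three factors equal to 1 are inserted, which turns the goal into an identity of rational
   functions. *)
have -> : W = W * (B * mu ^+ 3 * B) * (P * mu ^+ 3 * P') * (z ^- 2 / mu ^+ 8).
  by rewrite -c1 -cv mu8 mulfV ?invr_neq0 ?expf_neq0 // !mulr1.
rewrite /W /z; move: (1 - u ^+ 2)^-1 => r.
by field; rewrite ?u0 ?U0 ?M0 ?u1.
Qed.

Variables (beta : nat -> F) (M L : nat).
Hypothesis betaS : forall k, (k < M)%N ->
  beta k.+1 * (1 - Z ^+ k.+1) = beta k * (1 - z * Z ^+ k).
Hypothesis ME : M = (L * d + m)%N.

Let Zld l k : Z ^+ (l * d + k) = Z ^+ k.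
Proof. by rewrite exprD Zd mul1r. Qed.

Let poch_ld x l k : poch x Z (l * d + k) = poch x Z (l * d) * poch x Z k.
Proof.
elim: k => [|k IH]; first by rewrite addn0 poch0 mulr1.
by rewrite addnS !pochS IH Zld mulrA.
Qed.

(** Inside a block the factor [1 - Z^(k+1)] of the recurrence is invertible, so the recurrence
    determines [beta] from its value at the start of the block. At a multiple of [d] that factor
    vanishes, hence the free constant [beta (l * d)]. *)
Lemma beta_ld l k : (k < d)%N -> (l * d + k <= M)%N ->
  beta (l * d + k) = beta (l * d) * (poch z Z k / poch Z Z k).
Proof.
elim: k => [|k IH] kd le; first by rewrite addn0 !poch0 divr1 mulr1.
have h : 1 - Z ^+ k.+1 != 0 by apply: ZN1.
apply: (mulIf h); rewrite addnS in le *.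
have := betaS le; rewrite -addnS !Zld addnS => ->.
rewrite IH ?(ltnW kd) ?(ltnW le) // !pochS -exprS.
have pk : poch Z Z k != 0.
  by apply: poch_neq0 => i ik; rewrite -exprS ZN1 //; lia.
by field; rewrite h pk.
Qed.

Lemma lhs_term_ld l k : (k < d)%N -> (l * d + k <= M)%N ->
  lhs_term u v (beta (l * d + k)) (l * d + k) =
  (beta (l * d) ^+ 2 * (poch (v * z) Z (l * d) * poch (z / v) Z (l * d)) /
     (poch (v * Z) Z (l * d) * poch (Z / v) Z (l * d))) * base_term k.
Proof.
move=> kd le; rewrite /base_term /lhs_term beta_ld // -/z -/Z !poch_ld.
have zld j : z ^+ (l * d * j) = 1 by rewrite mulnAC mulnC exprM zd expr1n.
have -> : u ^+ (8 * (l * d + k) + 1) = u ^+ (8 * k + 1).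
  have -> : (8 * (l * d + k) + 1 = 2 * (l * d * 4) + (8 * k + 1))%N by lia.
  by rewrite exprD exprM zld mul1r.
have -> : u ^+ (2 * (8 * (l * d + k) + 1)) = u ^+ (2 * (8 * k + 1)).
  have -> : (2 * (8 * (l * d + k) + 1) = 2 * (l * d * 8) + 2 * (8 * k + 1))%N by lia.
  by rewrite exprD exprM zld mul1r.
have -> : u ^+ (4 * (l * d + k)) = u ^+ (4 * k).
  have -> : (4 * (l * d + k) = 2 * (l * d * 2) + 4 * k)%N by lia.
  by rewrite exprD exprM zld mul1r.
rewrite !invfM !exprMn; ring.
Qed.

Lemma sum_lhs_term_root_of_unity :
  \sum_(0 <= k < M.+1) lhs_term u v (beta k) k = 0.
Proof.
have base0 : \sum_(0 <= k < m.+1) base_term k = 0.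
  set S := LHS.
  have : S = - S.
    rewrite {1}/S big_nat_rev -sumrN; apply: eq_big_nat => i /andP[_ im].
    by rewrite add0n subSS base_term_anti.
  move/eqP; rewrite -addr_eq0 -mulr2n -mulr_natl mulf_eq0 (negPf char2) /=.
  by move/eqP.
have full l : (l <= L)%N -> \sum_(0 <= k < l * d) lhs_term u v (beta k) k = 0.
  elim: l => [|l IH] lL; first by rewrite mul0n big_geq.
  have ldM : (l.+1 * d <= M)%N by rewrite ME (leq_trans _ (leq_addr _ _)) ?leq_mul.
  rewrite mulSnr (big_cat_nat (leq0n _) (leq_addr _ _)) /= IH ?add0r ?(ltnW lL) //.
  rewrite -{1}[(l * d)%N]add0n big_addn addKn.
  transitivity (\sum_(0 <= k < d)
     (beta (l * d) ^+ 2 * (poch (v * z) Z (l * d) * poch (z / v) Z (l * d)) /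
     (poch (v * Z) Z (l * d) * poch (Z / v) Z (l * d))) * base_term k).
    apply: eq_big_nat => k /andP[_ kd]; rewrite addnC lhs_term_ld //.
    by move: ldM; rewrite mulSnr; lia.
  rewrite -mulr_sumr (big_cat_nat (leq0n m.+1) md) /= base0 add0r.
  by rewrite big_nat_cond big1 ?mulr0 // => k /andP[/andP[mk _] _]; apply: base_term_eq0.
have ldM : (L * d <= M.+1)%N by rewrite ME; lia.
(* The last block is cut off at [k = L d + m = M], which is just where its nonzero terms end. *)
rewrite (big_cat_nat (leq0n _) ldM) /= full // add0r.
rewrite -{1}[(L * d)%N]add0n big_addn ME -addnS addKn.
transitivity (\sum_(0 <= k < m.+1)
   (beta (L * d) ^+ 2 * (poch (v * z) Z (L * d) * poch (z / v) Z (L * d)) /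
   (poch (v * Z) Z (L * d) * poch (Z / v) Z (L * d))) * base_term k).
  apply: eq_big_nat => k /andP[_ km]; rewrite addnC lhs_term_ld //.
    by rewrite (leq_ltn_trans _ md).
  by rewrite ME leq_add2l.
by rewrite -mulr_sumr base0 mulr0.
Qed.

End RootOfUnity.

(** * Localization at the evaluation points *)

Definition Ft : fieldType := {fraction {poly algC}}.

Definition constF (c : algC) : Ft := tofrac c%:P.
HB.instance Definition _ := GRing.RMorphism.copy constF (@tofrac _ \o polyC).
Definition tF : Ft := tofrac 'X.
Definition ratF (c : rat) : Ft := constF (ratr c).
HB.instance Definition _ := GRing.RMorphism.copy ratF (constF \o ratr).

Definition evq (u : Ft) (p : {poly rat}) : Ft := (map_poly ratF p).[u].
HB.instance Definition _ u := GRing.RMorphism.copy (evq u) (horner_eval u \o map_poly ratF).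

Definition ev (u v : Ft) (p : Rqa) : Ft := (map_poly (evq u) p).[v].
HB.instance Definition _ u v := GRing.RMorphism.copy (ev u v) (horner_eval v \o map_poly (evq u)).

Lemma ev_q u v : ev u v qP = u.
Proof. by rewrite /ev /qP map_polyC hornerC /= /evq map_polyX hornerX. Qed.

Lemma ev_a u v : ev u v aP = v.
Proof. by rewrite /ev /aP map_polyX hornerX. Qed.

Lemma natF_eq0 n : (n%:R == 0 :> Ft) = (n == 0%N).
Proof.
have -> : n%:R = tofrac (n%:R) :> Ft by rewrite rmorph_nat.
by rewrite tofrac_eq0 -polyC_natr polyC_eq0 pnatr_eq0.
Qed.

(** * Fractions regular at all test points *)

Section Localization.
Variable test_pt : Ft -> Ft -> Prop.
Hypothesis test_pt_inhabited : exists u v, test_pt u v.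

Definition good (D : Rqa) := forall u v, test_pt u v -> ev u v D != 0.

(** Membership in the localization at the polynomials that vanish at no test point, with [f] as
    value function. One pair [N], [D] must serve all points: this makes [D] coprime to the whole
    modulus. *)
Definition loc (x : Kqa) (f : Ft -> Ft -> Ft) : Prop :=
  exists N D : Rqa, [/\ good D, x = (N%:F) / (D%:F) &
    forall u v, test_pt u v -> f u v = ev u v N / ev u v D].

Lemma good_neq0 D : good D -> D != 0.
Proof.
move=> g; have [u [v p]] := test_pt_inhabited; apply: contraNneq (g u v p) => ->.
by rewrite rmorph0.
Qed.

Lemma goodM D E : good D -> good E -> good (D * E).
Proof. by move=> gD gE u v p; rewrite rmorphM mulf_neq0 ?gD ?gE. Qed.

Lemma loc_ext x f g : (forall u v, test_pt u v -> f u v = g u v) -> loc x f -> loc x g.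
Proof. by move=> e [N [D [gD -> h]]]; exists N, D; split=> // u v p; rewrite -e ?h. Qed.

(** Transports identities of rational functions to the test points, even where the usual
    denominators vanish. *)
Lemma loc_unique x f g : loc x f -> loc x g -> forall u v, test_pt u v -> f u v = g u v.
Proof.
move=> [N [D [gD -> hf]]] [N' [D' [gD' e hg]]] u v p; rewrite hf ?hg //.
have D0 := good_neq0 gD; have D0' := good_neq0 gD'.
move/eqP: e; rewrite eqr_div ?tofrac_eq0 // -!tofracM tofrac_eq => /eqP e.
by apply/eqP; rewrite eqr_div ?gD ?gD' // -!rmorphM e.
Qed.

Lemma loc_poly N : loc (N%:F) (fun u v => ev u v N).
Proof.
exists N, 1; split; first by move=> u v _; rewrite rmorph1 oner_eq0.
  by rewrite tofrac1 divr1.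
by move=> u v _; rewrite rmorph1 divr1.
Qed.

Lemma loc_q : loc qF (fun u v => u).
Proof. by apply: loc_ext (loc_poly qP) => u v _; rewrite ev_q. Qed.

Lemma loc_a : loc aF (fun u v => v).
Proof. by apply: loc_ext (loc_poly aP) => u v _; rewrite ev_a. Qed.

Lemma loc1 : loc 1 (fun u v => 1).
Proof. by rewrite -(tofrac1 Rqa); apply: loc_ext (loc_poly 1) => u v _; rewrite rmorph1. Qed.

Lemma loc0 : loc 0 (fun u v => 0).
Proof. by rewrite -(tofrac0 Rqa); apply: loc_ext (loc_poly 0) => u v _; rewrite rmorph0. Qed.

Lemma locD x y f g : loc x f -> loc y g -> loc (x + y) (fun u v => f u v + g u v).
Proof.
move=> [N [D [gD -> hf]]] [N' [D' [gD' -> hg]]].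
exists (N * D' + N' * D), (D * D'); split; first exact: goodM.
  by rewrite addf_div ?tofrac_eq0 ?good_neq0 // tofracD !tofracM.
by move=> u v p; rewrite hf ?hg // addf_div ?gD ?gD' // rmorphD !rmorphM.
Qed.

Lemma locN x f : loc x f -> loc (- x) (fun u v => - f u v).
Proof.
move=> [N [D [gD -> hf]]]; exists (- N), D; split=> //.
  by rewrite tofracN mulNr.
by move=> u v p; rewrite hf // rmorphN mulNr.
Qed.

Lemma locB x y f g : loc x f -> loc y g -> loc (x - y) (fun u v => f u v - g u v).
Proof. by move=> hx hy; apply: locD => //; apply: locN. Qed.

Lemma locM x y f g : loc x f -> loc y g -> loc (x * y) (fun u v => f u v * g u v).
Proof.
move=> [N [D [gD -> hf]]] [N' [D' [gD' -> hg]]].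
exists (N * N'), (D * D'); split; first exact: goodM.
  by rewrite mulf_div !tofracM.
by move=> u v p; rewrite hf ?hg // mulf_div !rmorphM.
Qed.

Lemma locX x f n : loc x f -> loc (x ^+ n) (fun u v => f u v ^+ n).
Proof.
move=> hx; elim: n => [|n IH]; first exact: loc1.
rewrite exprS; apply: loc_ext (locM hx IH) => u v _; by rewrite exprS.
Qed.

Lemma locV x f : loc x f -> (forall u v, test_pt u v -> f u v != 0) ->
  loc x^-1 (fun u v => (f u v)^-1).
Proof.
move=> [N [D [gD -> hf]]] f0; exists D, N; split.
- move=> u v p; apply: contraNneq (f0 u v p) => e; by rewrite hf // e mul0r.
- by rewrite invf_div.
- by move=> u v p; rewrite hf // invf_div.
Qed.

Lemma loc_div x y f g : loc x f -> loc y g -> (forall u v, test_pt u v -> g u v != 0) ->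
  loc (x / y) (fun u v => f u v / g u v).
Proof. by move=> hx hy g0; apply: locM => //; apply: locV. Qed.

Lemma loc_sum n (x : nat -> Kqa) f :
  (forall i, (i < n)%N -> loc (x i) (f i)) ->
  loc (\sum_(i < n) x i) (fun u v => \sum_(i < n) f i u v).
Proof.
elim: n => [|n IH] h.
  by rewrite big_ord0; apply: loc_ext loc0 => u v _; rewrite big_ord0.
rewrite big_ord_recr /=.
apply: loc_ext (locD (IH (fun i lt => h i (ltnW lt))) (h n (ltnSn n))) => u v _.
by rewrite big_ord_recr.
Qed.

Lemma loc_prod n (x : nat -> Kqa) f :
  (forall i, (i < n)%N -> loc (x i) (f i)) ->
  loc (\prod_(i < n) x i) (fun u v => \prod_(i < n) f i u v).
Proof.
elim: n => [|n IH] h.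
  by rewrite big_ord0; apply: loc_ext loc1 => u v _; rewrite big_ord0.
rewrite big_ord_recr /=.
apply: loc_ext (locM (IH (fun i lt => h i (ltnW lt))) (h n (ltnSn n))) => u v _.
by rewrite big_ord_recr.
Qed.

End Localization.

Lemma horner_cst (p : {poly algC}) : (map_poly constF p).[tF] = tofrac p.
Proof.
rewrite (map_poly_comp (@tofrac {poly algC}) polyC) horner_map.
by rewrite -/(comp_poly 'X p) comp_polyXr.
Qed.

Lemma evq_tF p : evq tF p = tofrac (map_poly ratr p).
Proof. by rewrite /evq (map_poly_comp constF ratr) horner_cst. Qed.

Lemma evq_tF_eq0 p : (evq tF p == 0) = (p == 0).
Proof. by rewrite evq_tF tofrac_eq0 map_poly_eq0. Qed.

Definition evc (w : algC) (p : {poly rat}) : algC := (map_poly ratr p).[w].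
HB.instance Definition _ w := GRing.RMorphism.copy (evc w) (horner_eval w \o map_poly ratr).

Lemma evq_cst w p : evq (constF w) p = constF (evc w p).
Proof. by rewrite /evq (map_poly_comp constF ratr) horner_map. Qed.

(** As [t] is transcendental, evaluation at [(w, t)] loses no more than the reduction of the
    coefficients at [q = w]. *)
Lemma ev_cst w D : ev (constF w) tF D = tofrac (map_poly (evc w) D).
Proof.
rewrite -horner_cst -map_poly_comp; congr (_.[_]).
by apply: eq_map_poly => p /=; rewrite evq_cst.
Qed.

Lemma tF_neq0 : tF != 0.
Proof. by rewrite tofrac_eq0 polyX_eq0. Qed.

Lemma tFX i : tF ^+ i = tofrac 'X^i.
Proof. by rewrite tofracXn. Qed.

Lemma tF_cst i w : (0 < i)%N -> tF ^+ i != constF w.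
Proof.
move=> i0; rewrite tFX tofrac_eq; apply/eqP => /(congr1 (fun p => size (polyseq p))).
by rewrite size_polyXn size_polyC; case: i i0 => // i _; case: (_ != _).
Qed.

Lemma tFX_neq1 i : (0 < i)%N -> 1 - tF ^+ i != 0.
Proof.
by move=> i0; rewrite subr_eq0 eq_sym -(rmorph1 constF) tF_cst.
Qed.

(** The multiples of [p] form the kernel of an evaluation into a field. If [g] divides [D] and
    [x * p = h * g], then [g] is nonzero at the point, so [h] vanishes there; hence [p] divides [h]
    and cancels, and [g] divides [x]. *)
Lemma pcoprime_mul_prime (D x p : Rqa) (u v : Ft) :
  p != 0 -> (forall y, ev u v y = 0 <-> pdvd p y) -> ev u v D != 0 ->
  pcoprime D x -> pcoprime D (x * p).
Proof.
move=> p0 pP Dp cop g gD [h e]; apply: cop => //.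
have pv : ev u v p = 0 by apply/pP; exists 1; rewrite mul1r.
have : ev u v (h * g) = 0 by rewrite -e rmorphM /= pv mulr0.
rewrite rmorphM => /eqP; rewrite mulf_eq0 => /orP[] /eqP; last first.
  move=> g0; case: gD Dp => c ->; by rewrite rmorphM g0 mulr0 eqxx.
move/pP => [h' eh]; exists h'; apply: (mulIf p0).
by rewrite e eh mulrAC.
Qed.

(** * Coprimality and divisibility read off at the test points *)

Section Modulus.
Variable n : nat.
Hypothesis n0 : (0 < n)%N.

Definition c2n : {poly rat} := 'X^(2 * n).
Definition L1 : Rqa := 1 - aP * qP ^+ (2 * n).
Definition L2 : Rqa := aP - qP ^+ (2 * n).
Definition pn : {poly rat} := \sum_(i < n) 'X^(2 * i).

Lemma qPX i : qP ^+ i = ('X^i)%:P.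
Proof. by rewrite polyC_exp. Qed.

Lemma qint2PE : qint2P n = pn%:P.
Proof. by rewrite /qint2P /pn rmorph_sum; apply: eq_bigr => i _; rewrite qPX. Qed.

Lemma ev_L1 u v : ev u v L1 = 1 - v * u ^+ (2 * n).
Proof. by rewrite rmorphB rmorphM rmorph1 rmorphXn /= ev_a ev_q. Qed.

Lemma ev_L2 u v : ev u v L2 = v - u ^+ (2 * n).
Proof. by rewrite rmorphB rmorphXn /= ev_a ev_q. Qed.

(** Since [evq tF] is injective, vanishing at the point means that substituting [a = q^(2n)] gives
    zero over Q[q]; the factor theorem in [a] applies. *)
Lemma L2P y : ev tF (tF ^+ (2 * n)) y = 0 <-> pdvd L2 y.
Proof.
split=> [|[c ->]]; last by rewrite rmorphM /= ev_L2 subrr mulr0.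
have -> : tF ^+ (2 * n) = evq tF c2n by rewrite /evq map_polyXn hornerXn.
rewrite /ev horner_map => /eqP; rewrite evq_tF_eq0 => /factor_theorem[c ->].
by exists c; rewrite /L2 qPX.
Qed.

(** [L1] is not monic in [a], but its constant term in [a] is 1, so division proceeds from the
    constant term upwards, by induction on the degree in [a]. *)
Lemma L1P y : ev tF (tF ^- (2 * n)) y = 0 <-> pdvd L1 y.
Proof.
have t0 : tF ^+ (2 * n) != 0 by rewrite expf_neq0 ?tF_neq0.
split=> [|[c ->]]; last by rewrite rmorphM /= ev_L1 mulVf // subrr mulr0.
move: {2}(size y) (leqnn (size y)) => k; elim: k y => [|k IH] y.
  by rewrite leqn0 size_poly_eq0 => /eqP -> _; exists 0; rewrite mul0r.
move=> sy y0.
have yE : y = (y`_0)%:P + drop_poly 1 y * aP.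
  rewrite -{1}(poly_take_drop 1 y) expr1; congr (_ + _).
  by apply/polyP => i; rewrite coef_take_poly coefC; case: i.
have [sy1|sy1] := leqP (size y) 1.
  move: y0; rewrite [y]size1_polyC // /ev map_polyC hornerC => /eqP.
  by rewrite evq_tF_eq0 => /eqP ->; exists 0; rewrite mul0r polyC0.
(* Chosen so that the polynomial equals [y_0 * L1 + aP * y'], where [y_0] is its constant
   coefficient in [a]; [y'] has smaller degree and still vanishes at the point because [a] is
   nonzero there. *)
set y' := drop_poly 1 y + (c2n * y`_0)%:P.
have [E eE] : pdvd L1 y'.
  apply: IH.
    apply: leq_trans (size_polyD _ _) _; rewrite geq_max size_drop_poly leq_subLR add1n sy /=.
    by apply: leq_trans (size_polyC_leq1 _) _; lia.
  have : tF ^- (2 * n) * ev tF (tF ^- (2 * n)) y' = ev tF (tF ^- (2 * n)) y.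
    rewrite [in RHS]yE /y' !rmorphD !rmorphM /= ev_a mulrDr [in RHS]addrC.
    congr (_ + _); first exact: mulrC.
    have <- : qP ^+ (2 * n) = c2n%:P by rewrite qPX.
    by rewrite rmorphXn /= ev_q mulrA mulVf // mul1r.
  by rewrite y0 => /eqP; rewrite mulf_eq0 invr_eq0 (negPf t0) /= => /eqP.
exists ((y`_0)%:P + aP * E).
rewrite mulrDl -mulrA -eE /y' /L1 qPX -/c2n {1}yE polyCM; ring.
Qed.


Definition test_pt (u v : Ft) : Prop :=
  (exists w : algC, [/\ u = constF w, v = tF, w ^+ (2 * n) = 1 & w ^+ 2 != 1]) \/
  (u = tF /\ (v = tF ^+ (2 * n) \/ v = tF ^- (2 * n))).

Lemma test_pt_inhabited : exists u v, test_pt u v.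
Proof. by exists tF, (tF ^+ (2 * n)); right; split=> //; left. Qed.

Lemma pn_mul : pn * ('X^2 - 1) = 'X^(2 * n) - 1.
Proof.
rewrite mulrC [in RHS]exprM [RHS]subrX1; congr (_ * _).
by apply: eq_bigr => i _; rewrite exprM.
Qed.

Lemma pn_neq0 : pn != 0.
Proof.
apply/negP => /eqP p0; have := pn_mul; rewrite p0 mul0r => /esym/eqP.
apply/negP; rewrite -size_poly_eq0 size_XnsubC //; lia.
Qed.

(** From [pn * (X^2 - 1) = X^(2n) - 1]; where [w^2 = 1], the value of [pn] is [n], which is
    nonzero. *)
Lemma pn_root w : evc w pn = 0 <-> w ^+ (2 * n) = 1 /\ w ^+ 2 != 1.
Proof.
have h : evc w pn * (w ^+ 2 - 1) = w ^+ (2 * n) - 1.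
  have := congr1 (evc w) pn_mul.
  by rewrite rmorphM !rmorphB !rmorph1 !rmorphXn /= /evc map_polyX hornerX.
have pw : w ^+ 2 = 1 -> evc w pn = n%:R.
  move=> e; rewrite /pn rmorph_sum /= -[X in X%:R]card_ord -sumr_const.
  apply: eq_bigr => i _.
  by rewrite /evc map_polyXn hornerXn exprM e expr1n.
split=> [e|[e /negPf w1]].
  split; first by apply/eqP; rewrite -subr_eq0 -h e mul0r.
  by apply: contra_eq_neq e => /pw ->; rewrite pnatr_eq0 -lt0n.
by move/eqP: h; rewrite e subrr mulf_eq0 subr_eq0 w1 orbF => /eqP.
Qed.

(** As a divisor of the separable [X^(2n) - 1], [pn] has distinct roots in [algC]; divisibility
    there descends to the rationals. *)
Lemma pn_dvdp (f : {poly rat}) :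
  (forall w, evc w pn = 0 -> evc w f = 0) -> pn %| f.
Proof.
move=> h; rewrite -(dvdp_map (ratr : {rmorphism rat -> algC})).
have [r er] := closed_field_poly_normal (map_poly ratr pn : {poly algC}).
have lc0 : lead_coef (map_poly ratr pn : {poly algC}) != 0.
  by rewrite lead_coef_eq0 map_poly_eq0 pn_neq0.
rewrite er dvdpZl //.
apply: uniq_roots_dvdp.
  apply/allP => w wr; apply/rootP/h; rewrite /evc er hornerZ.
  by move: wr; rewrite -root_prod_XsubC => /rootP ->; rewrite mulr0.
rewrite uniq_rootsE -separable_prod_XsubC.
have : separable_poly ('X^(2 * n) - 1 : {poly algC}).
  by apply: separable_Xn_sub_1; rewrite pnatr_eq0; lia.
apply: dvdp_separable.
have := congr1 (map_poly (ratr : rat -> algC)) pn_mul.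
rewrite rmorphM !rmorphB /= !map_polyXn !rmorph1 => <-.
by rewrite er -scalerAl dvdpZr // dvdp_mulr.
Qed.

Lemma pt_root w : evc w pn = 0 -> test_pt (constF w) tF.
Proof. by move=> /pn_root[e1 e2]; left; exists w. Qed.

(** A common divisor has degree 0 in [a], as [pn] does. If it were not constant in [q], it would
    have a complex root [w], also a root of [pn], and [D] would vanish at the test point
    [(w, t)]. *)
Lemma good_pcoprime_pn D : good test_pt D -> pcoprime D pn%:P.
Proof.
move=> gD g [c eD] [h eP].
have := congr1 (fun p => size (polyseq p)) eP; rewrite /= size_polyC pn_neq0.
have /andP[h0 g0] : (h != 0) && (g != 0).
  rewrite -negb_or -mulf_eq0 -eP polyC_eq0 pn_neq0 //.
rewrite size_mul // => sz.
have sg : size g = 1%N.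
  move: sz h0 g0; rewrite -!size_poly_eq0.
  by case: (size h) (size g) => [|a] [|[|b]] //; rewrite addSn !addnS.
have eg := size1_polyC (eq_leq sg); move: g0 eP eD; rewrite {}eg.
move: g`_0 => {sz sg} g; rewrite polyC_eq0 => g0 eP eD.
have [/eqP sg|sg] := eqVneq (size (map_poly ratr g : {poly algC})) 1%N.
  move: sg; rewrite size_map_poly => /eqP sg.
  have eg := size1_polyC (eq_leq sg); rewrite eg.
  have c0 : g`_0 != 0 by rewrite -polyC_eq0 -eg.
  apply/GRing.unitrPr; exists ((g`_0)^-1)%:P%:P.
  by rewrite -!polyCM mulfV.
have /closed_rootP[w /rootP gw] := sg.
have ew : evc w pn = 0.
  have := congr1 (fun p : Rqa => evc w p`_0) eP.
  by rewrite coefMC coefC eqxx rmorphM /= => ->; rewrite {2}/evc gw mulr0.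
have := gD _ _ (pt_root ew); rewrite eD rmorphM /=.
by rewrite {2}/ev map_polyC hornerC /= evq_cst /evc gw rmorph0 mulr0 eqxx.
Qed.

Lemma good_pcoprime D : good test_pt D -> pcoprime D (qint2P n * L1 * L2).
Proof.
move=> gD; rewrite qint2PE.
have t0 : tF ^+ (2 * n) != 0 by rewrite expf_neq0 ?tF_neq0.
have L10 : L1 != 0.
  apply/eqP => e; have := ev_L1 tF 0; rewrite e rmorph0 mul0r subr0 => /eqP.
  by rewrite eq_sym oner_eq0.
have L20 : L2 != 0.
  apply/eqP => e; have := ev_L2 tF 0; rewrite e rmorph0 sub0r => /eqP.
  by rewrite eq_sym oppr_eq0 (negPf t0).
apply: (pcoprime_mul_prime L20 L2P); first by apply: gD; right; split=> //; left.
apply: (pcoprime_mul_prime L10 L1P); first by apply: gD; right; split=> //; right.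
exact: good_pcoprime_pn.
Qed.

(** [L2], [L1] and [pn] are split off in turn. The factors already removed do not vanish at the
    later points: [L2] is nonzero at [a = t^(-2n)], and at [(w, t)] the two linear factors are
    [1 - t] and [t - 1]. *)
Lemma vanish_pdvd N : (forall u v, test_pt u v -> ev u v N = 0) ->
  pdvd (qint2P n * L1 * L2) N.
Proof.
move=> h; rewrite qint2PE.
have t0 : tF ^+ (2 * n) != 0 by rewrite expf_neq0 ?tF_neq0.
have /L2P [N1 e1] : ev tF (tF ^+ (2 * n)) N = 0 by apply: h; right; split=> //; left.
have /L1P [N2 e2] : ev tF (tF ^- (2 * n)) N1 = 0.
  have : ev tF (tF ^- (2 * n)) N = 0 by apply: h; right; split=> //; right.
  rewrite e1 rmorphM /= ev_L2 => /eqP; rewrite mulf_eq0 => /orP[/eqP //|].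
  have -> : tF ^- (2 * n) - tF ^+ (2 * n) = (1 - tF ^+ (2 * n + 2 * n)) / tF ^+ (2 * n).
    by rewrite exprD mulrBl mul1r mulfK.
  by rewrite mulf_eq0 invr_eq0 (negPf t0) orbF (negPf (tFX_neq1 _)) //; lia.
have N2v w : evc w pn = 0 -> map_poly (evc w) N2 = 0.
  move=> rw; have pw := pt_root rw; have := h _ _ pw.
  have [w1 _] := (pn_root w).1 rw.
  have cw : constF w ^+ (2 * n) = 1 by rewrite -rmorphXn w1 rmorph1.
  have t1 : 1 - tF != 0 by have := @tFX_neq1 1 isT.
  rewrite e1 e2 !rmorphM /= ev_L1 ev_L2 cw mulr1 => /eqP.
  rewrite !mulf_eq0 (negPf t1) -opprB oppr_eq0 (negPf t1) !orbF ev_cst tofrac_eq0.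
  by move/eqP.
(* [pn] is free of [a], so the division by it is done coefficient by coefficient. *)
exists (map_poly (fun x => x %/ pn) N2).
rewrite e1 e2 !mulrA; congr (_ * _ * _).
apply/polyP => i; rewrite coefMC coef_map_id0 ?div0p // divpK //.
apply: pn_dvdp => w /N2v /(congr1 (fun p : {poly algC} => p`_i)).
by rewrite coef_map coef0.
Qed.

Lemma loc0_congr_mod A B : loc test_pt (A - B) (fun _ _ => 0) ->
  congr_mod A B (qint2P n * L1 * L2).
Proof.
move=> [N [D [gD e h]]]; exists N, D; split; first exact: good_neq0 test_pt_inhabited _ gD.
split=> //; split; first exact: good_pcoprime.
apply: vanish_pdvd => u v p; apply/eqP; have /esym/eqP := h u v p.
by rewrite mulf_eq0 invr_eq0 (negPf (gD u v p)) orbF.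
Qed.

End Modulus.

(** * Regularity of the coefficients *)

(** The Gaussian binomial, defined by the q-Pascal rule so that it is visibly a polynomial in
    [x]. *)
Fixpoint gauss (K : fieldType) (x : K) (N k : nat) : K :=
  match N, k with
  | _, 0 => 1
  | 0, _.+1 => 0
  | N'.+1, k'.+1 => gauss x N' k' + x ^+ k * gauss x N' k
  end.

Definition geom_sum (K : fieldType) (x : K) (m : nat) : K := \sum_(j < m) x ^+ j.

(* Equals [(1 - x^s) / (1 - x^t)] when [gcd (t, n)] divides [s]; the common factor
   [1 - x^(gcd (t, n))] is removed so that the denominator stays nonzero at
   [n]-th roots of unity. *)
Definition gratio (K : fieldType) (n : nat) (x : K) (s t : nat) : K :=
  let e := gcdn t n in geom_sum (x ^+ e) (s %/ e) / geom_sum (x ^+ e) (t %/ e).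

(** A form of [(x^c; x^4)_k / (x^4; x^4)_k] for [k <= N] and [n] dividing [c + 4N]. The summands use
    [c = 1], [N = M], and the right-hand side uses [c = 2], [N = 2M]. *)
Definition poch_quot (K : fieldType) (n : nat) (x : K) (c N k : nat) : K :=
  gauss (x ^+ 4) N k * \prod_(i < k) gratio n x (c + 4 * i) (4 * (N - i)).

Section Regular.
Variable K : fieldType.
Implicit Types x : K.

Lemma geoE x m : 1 - x ^+ m = (1 - x) * geom_sum x m.
Proof. by rewrite -opprB subrX1 -mulNr opprB. Qed.

Lemma gauss_poch x N k :
  gauss x N k * poch x x k = \prod_(i < k) (1 - x ^+ (N - i)).
Proof.
elim: N k => [|N IH] [|k] /=; rewrite ?poch0 ?big_ord0 ?mulr1 //.
  by rewrite mul0r big_ord_recl subn0 expr0 subrr mul0r.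
have fallS : \prod_(i < k.+1) (1 - x ^+ (N - i)) =
    \prod_(i < k) (1 - x ^+ (N - i)) * (1 - x ^+ (N - k)) by rewrite big_ord_recr.
rewrite big_ord_recl subn0 (eq_bigr (fun i : 'I_k => 1 - x ^+ (N - i))); last first.
  by move=> i _; rewrite lift0 subSS.
rewrite mulrDl -mulrA IH fallS -IH pochS -exprS.
have [kN|Nk] := leqP k N.
  have -> : x ^+ N.+1 = x ^+ k.+1 * x ^+ (N - k) by rewrite -exprD addSn subnKC.
  ring.
suff -> : gauss x N k = 0 by ring.
by elim: N k Nk {IH fallS} => [|N IH] [|k] //= lt; rewrite !IH ?mulr0 ?addr0 //; lia.
Qed.

Lemma gratioE n x s t : (0 < n)%N -> (gcdn t n %| s)%N ->
  geom_sum (x ^+ gcdn t n) (t %/ gcdn t n) != 0 ->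
  gratio n x s t * (1 - x ^+ t) = 1 - x ^+ s.
Proof.
move=> n0 es g0; rewrite /gratio; set e := gcdn t n in es g0 *.
have et : (e %| t)%N by apply: dvdn_gcdl.
have xE r : (e %| r)%N -> x ^+ r = x ^+ e ^+ (r %/ e).
  by move=> er; rewrite -exprM mulnC divnK.
rewrite (xE s es) (xE t et) !geoE.
by rewrite mulrCA mulfVK // mulrC.
Qed.

(** The numerators of the Gaussian binomial cancel the denominators of the [gratio] factors. These
    are legitimate: [n] divides [(c + 4i) + 4(N - i)], so the gcd of [4(N - i)] and [n] divides
    [c + 4i]. *)
Lemma poch_quotE n x c N k : (0 < n)%N -> (n %| c + 4 * N)%N -> (k <= N)%N ->
  (forall t, (0 < t)%N -> geom_sum (x ^+ gcdn t n) (t %/ gcdn t n) != 0) ->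
  poch_quot n x c N k * poch (x ^+ 4) (x ^+ 4) k = poch (x ^+ c) (x ^+ 4) k.
Proof.
move=> n0 nc kN g0; rewrite /poch_quot mulrAC gauss_poch -big_split /=.
apply: eq_bigr => i _; have iN := leq_trans (ltn_ord i) kN.
rewrite -!exprM -exprD mulrC gratioE //; last by apply: g0; lia.
have : (gcdn (4 * (N - i)) n %| c + 4 * N)%N by apply: dvdn_trans nc; apply: dvdn_gcdr.
have -> : (c + 4 * N = 4 * (N - i) + (c + 4 * i))%N by move: iN; lia.
by rewrite dvdn_addr ?dvdn_gcdl.
Qed.

End Regular.

(** * Nonvanishing of denominators at the test points *)

Section Points.
Variable M : nat.
Let n := (4 * M + 1)%N.
Let n0 : (0 < n)%N. Proof. by rewrite /n addn1. Qed.
Let test_pt := test_pt n.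

Variables u v : Ft.
Hypothesis uv : test_pt u v.

Lemma pt_u_neq0 : u != 0.
Proof.
case: uv => [[w [-> _ w1 _]]|[-> _]]; last exact: tF_neq0.
rewrite fmorph_eq0; apply: contra_eq_neq w1 => ->.
by rewrite expr0n muln_eq0 /= gtn_eqF // eq_sym oner_eq0.
Qed.

Lemma pt_v_neq0 : v != 0.
Proof.
by case: uv => [[w [_ -> _ _]]|[_ [|] ->]]; rewrite ?invr_eq0 ?expf_neq0 ?tF_neq0.
Qed.

Lemma pt_u2 : 1 - u ^+ 2 != 0.
Proof.
case: uv => [[w [-> _ _ w1]]|[-> _]]; last exact: tFX_neq1.
by rewrite -(rmorph1 constF) -rmorphXn -rmorphB fmorph_eq0 subr_eq0 eq_sym.
Qed.

Lemma pt_u1 : 1 - u != 0.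
Proof.
apply: contraNneq pt_u2 => e; apply/eqP.
by rewrite -{1}(expr1n _ 2) subr_sqr e mul0r.
Qed.

(** As [n] is odd, [u^2 = -1] would give [u^(2n) = -1] at a root of unity. *)
Lemma pt_u2p : 1 + u ^+ 2 != 0.
Proof.
apply/eqP => /eqP; rewrite addrC addr_eq0 => /eqP e.
case: uv => [[w [uw _ w1 _]]|[ut _]].
  have : u ^+ (2 * n) = 1 by rewrite uw -rmorphXn w1 rmorph1.
  rewrite exprM e -signr_odd /n oddD oddM /= expr1 => /eqP.
  by rewrite eq_sym -addr_eq0 -mulr2n natF_eq0.
have : 1 - tF ^+ 4 = 0 by rewrite -ut (exprM u 2 2) e sqrrN expr1n subrr.
by apply/eqP; apply: tFX_neq1.
Qed.

Lemma pt_vk k : 1 - v * (u ^+ 8) ^+ k != 0.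
Proof.
case: uv => [[w [-> -> w1 _]]|[-> [|] ->]].
- have c0 : constF w ^+ 8 ^+ k != 0.
    rewrite !expf_neq0 // fmorph_eq0; apply: contra_eq_neq w1 => ->.
    by rewrite expr0n muln_eq0 /= gtn_eqF // eq_sym oner_eq0.
  rewrite subr_eq0 eq_sym; apply/negP => /eqP e.
  have : tF ^+ 1 = constF ((w ^+ 8 ^+ k)^-1).
    by rewrite fmorphV !rmorphXn expr1; apply: (mulIf c0); rewrite e mulVf.
  by apply/eqP; apply: tF_cst.
- by rewrite -exprM -exprD tFX_neq1 // /n; lia.
- have t0 : tF ^+ (2 * n) != 0 by rewrite expf_neq0 ?tF_neq0.
  (* A zero would require [8k = 2n], which is impossible for odd [n]. *)
  rewrite -exprM subr_eq0 eq_sym mulrC; apply/negP => /eqP /(canRL (mulfVK t0)).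
  rewrite mul1r => /eqP; rewrite -!tofracXn tofrac_eq => /eqP.
  by move=> /(congr1 (fun p => size (polyseq p))); rewrite !size_polyXn /n; lia.
Qed.

(** Let [e = gcd(t, n)]. If [u^(2e) = 1], the sum is the positive integer [t / e]. Otherwise a zero
    would force [u^(2t) = 1], and at a root of unity Bezout with [u^(2n) = 1] would give
    [u^(2e) = 1]. *)
Lemma pt_geom_sum t : (0 < t)%N -> geom_sum (u ^+ 2 ^+ gcdn t n) (t %/ gcdn t n) != 0.
Proof.
move=> t0; set e := gcdn t n; have e0 : (0 < e)%N by rewrite gcdn_gt0 t0.
have et : (e %| t)%N by apply: dvdn_gcdl.
have [x1|x1] := eqVneq (u ^+ 2 ^+ e) 1.
  rewrite x1 /geom_sum (eq_bigr (fun=> 1)) => [|i _]; last by rewrite expr1n.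
  by rewrite sumr_const card_ord natF_eq0 -lt0n divn_gt0 // dvdn_leq.
apply/eqP => g0; have : u ^+ 2 ^+ t = 1.
  apply/eqP; rewrite eq_sym -subr_eq0 -(divnK et) mulnC exprM geoE g0 mulr0 //.
case: uv => [[w [uw _ w1 _]]|[-> _]]; last first.
  by move/eqP; rewrite -exprM eq_sym -subr_eq0 (negPf (tFX_neq1 _)) // muln_gt0.
move=> ut; have un : u ^+ 2 ^+ n = 1 by rewrite uw -exprM -rmorphXn w1 rmorph1.
move/eqP: x1; apply; rewrite /e; case: (egcdnP n t0) => a b ab _.
have := congr1 (fun j => u ^+ 2 ^+ j) ab.
by rewrite /= exprD mulnC exprM ut expr1n mulnC exprM un expr1n mul1r => <-.
Qed.

End Points.

Lemma pt_vVk M u v k : test_pt (4 * M + 1) u v -> 1 - v^-1 * (u ^+ 8) ^+ k != 0.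
Proof.
move=> uv; case: (uv) => [[w [uw vt _ _]]|[ut h]]; last first.
  apply: (@pt_vk M); right; split=> //.
  by case: h => ->; [right|left]; rewrite ?invrK.
rewrite subr_eq0 eq_sym; apply/negP => /eqP /(canRL (mulVKf (pt_v_neq0 uv))).
rewrite mulr1 vt => e; have : tF ^+ 1 = constF (w ^+ 8 ^+ k) by rewrite !rmorphXn expr1 -e uw.
by apply/eqP; apply: tF_cst.
Qed.

(** * Regularity of both sides of the congruence *)

Section Local.
Variable M : nat.
Let n := (4 * M + 1)%N.
Let n0 : (0 < n)%N. Proof. by rewrite /n addn1. Qed.
Notation loc := (loc (test_pt n)).
Let inh : exists u v, test_pt n u v := test_pt_inhabited n.

Lemma loc_neq0 x f u v : loc x f -> test_pt n u v -> f u v != 0 -> x != 0.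
Proof.
move=> lx p; apply: contraNneq => x0; rewrite x0 in lx.
by rewrite (loc_unique inh lx (loc0 _) p).
Qed.

Lemma loc_geom_sum x f m : loc x f -> loc (geom_sum x m) (fun u v => geom_sum (f u v) m).
Proof.
move=> lx; apply: (loc_sum inh (x := fun j => x ^+ j)
  (f := fun j u v => f u v ^+ j)) => i _; exact: locX.
Qed.

Lemma loc_poch x r f g k : loc x f -> loc r g ->
  loc (poch x r k) (fun u v => poch (f u v) (g u v) k).
Proof.
move=> lx lr; apply: (loc_prod (x := fun j => 1 - x * r ^+ j)
  (f := fun j u v => 1 - f u v * g u v ^+ j)) => i _.
apply: (locB inh); first exact: loc1.
by apply: locM => //; apply: locX.
Qed.

Lemma loc_gauss x f N k : loc x f -> loc (gauss x N k) (fun u v => gauss (f u v) N k).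
Proof.
move=> lx; elim: N k => [|N IH] [|k] /=; [exact: loc1|exact: loc0|exact: loc1|].
apply: (locD inh); first exact: IH.
by apply: locM; [apply: locX|apply: IH].
Qed.

Let lq2 : loc (qF ^+ 2) (fun u v => u ^+ 2).
Proof. by apply: locX; apply: loc_q. Qed.

Lemma loc_poch_quot c N k : (k <= N)%N ->
  loc (poch_quot n (qF ^+ 2) c N k) (fun u v => poch_quot n (u ^+ 2) c N k).
Proof.
move=> kN; apply: locM; first by apply: loc_gauss; apply: locX.
apply: (loc_prod (x := fun i => gratio n (qF ^+ 2) (c + 4 * i) (4 * (N - i)))
  (f := fun i u v => gratio n (u ^+ 2) (c + 4 * i) (4 * (N - i)))) => i ik.
apply: loc_div; try by apply: loc_geom_sum; apply: locX.
by move=> u v p; apply: (pt_geom_sum p); lia.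
Qed.

Lemma qF_geom_sum t : (0 < t)%N -> geom_sum (qF ^+ 2 ^+ gcdn t n) (t %/ gcdn t n) != 0.
Proof.
move=> t0; have [u [v p]] := inh.
exact: (loc_neq0 (loc_geom_sum _ (locX _ lq2)) p (pt_geom_sum p t0)).
Qed.

Lemma qF_poch_quot c N k : (n %| c + 4 * N)%N -> (k <= N)%N ->
  poch_quot n (qF ^+ 2) c N k = poch (qF ^+ (2 * c)) (qF ^+ 8) k / poch (qF ^+ 8) (qF ^+ 8) k.
Proof.
move=> nc kN; have := poch_quotE n0 nc kN qF_geom_sum; rewrite -!exprM => <-.
rewrite mulfK //; apply: poch_neq0 => i _.
have p : test_pt n tF (tF ^+ (2 * n)) by right; split=> //; left.
apply: (loc_neq0 (locB inh (loc1 _) (locM (locX 8 (loc_q _)) (locX i (locX 8 (loc_q _))))) p).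
by rewrite -exprM -exprD tFX_neq1.
Qed.

Lemma tF_poch_quot v c N k : test_pt n tF v -> (n %| c + 4 * N)%N -> (k <= N)%N ->
  poch_quot n (tF ^+ 2) c N k = poch (tF ^+ (2 * c)) (tF ^+ 8) k / poch (tF ^+ 8) (tF ^+ 8) k.
Proof.
move=> p nc kN; have := poch_quotE n0 nc kN (fun t => pt_geom_sum p (t := t)).
rewrite -!exprM => <-.
rewrite mulfK //; apply: poch_neq0 => i _.
by rewrite -exprM -exprD tFX_neq1.
Qed.

Lemma loc_lhs_term b f k : loc b f ->
  loc (lhs_term qF aF b k) (fun u v => lhs_term u v (f u v) k).
Proof.
move=> lb; have lq := loc_q (test_pt n); have la := loc_a (test_pt n); have l1 := loc1 (test_pt n).
have lX := @locX (test_pt n); have lM := @locM (test_pt n); have lB := locB inh.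
have ld := @loc_div (test_pt n).
have u0 := @pt_u_neq0 M; have v0 := @pt_v_neq0 M.
have uX i u v : test_pt n u v -> u ^+ i != 0 by move=> p; rewrite expf_neq0 // (u0 _ _ p).
rewrite /lhs_term.
apply: (lM); [apply: (lM); [apply: (lM)|]|].
- by apply: (ld); [apply: (lB) => //; apply: (lX)|apply: (lB) => //; apply: (lX)|exact: pt_u2].
- apply: (lX); apply: (ld); [by apply: (lB) => //; apply: (lX)|exact: lB|exact: pt_u1].
- apply: (ld); [apply: (lM); [exact: lX|]|apply: (lM)|].
  + apply: (lM); apply: loc_poch; try exact: lX; [by apply: lM => //; apply: lX|].
    by apply: ld => //; first [exact: v0 | exact: lX].
  + by apply: loc_poch; [apply: lM => //; apply: lX|apply: lX].
  + by apply: loc_poch; [apply: ld => //; first [exact: v0 | exact: lX]|apply: lX].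
  + move=> u v p; rewrite mulf_neq0 //; apply: poch_neq0 => i _.
      by rewrite -mulrA -exprS (pt_vk p).
    by rewrite mulrAC -exprS mulrC (pt_vVk _ p).
- by apply: locV; [apply: lX|move=> u v p; apply: uX p].
Qed.

Lemma loc_rhs d f : loc d f ->
  loc (rhs qF aF d M) (fun u v => rhs u v (f u v) M).
Proof.
move=> lb; have lq := loc_q (test_pt n); have la := loc_a (test_pt n); have l1 := loc1 (test_pt n).
have lX := @locX (test_pt n); have lM := @locM (test_pt n); have lB := locB inh.
have ld := @loc_div (test_pt n).
have u0 := @pt_u_neq0 M; have v0 := @pt_v_neq0 M.
have uX i u v : test_pt n u v -> u ^+ i != 0 by move=> p; rewrite expf_neq0 // (u0 _ _ p).
rewrite /rhs.
apply: (lM); [apply: (lM); [apply: (lM) => //|]|].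
- by apply: (ld); [apply: (lB) => //; apply: (lX)|apply: (lB) => //; apply: (lX)|exact: pt_u2].
- by apply: locV; [apply: lX|move=> u v p; apply: uX p].
apply: (lB) => //; apply: (ld).
- apply: (lM); apply: lB => //; [by apply: lM => //; apply: lX|].
  by apply: ld => //; first [exact: v0 | exact: lX].
- apply: (lM); [by apply: (lX); apply: lB|].
  by apply: (locD inh) => //; apply: lX.
move=> u v p; apply: mulf_neq0; last exact: pt_u2p p.
by apply: expf_neq0; apply: pt_u1 p.
Qed.

End Local.

(** * Equality of the two sides at every test point *)

Section Evaluation.
Variable M : nat.
Let n := (4 * M + 1)%N.
Let n0 : (0 < n)%N. Proof. by rewrite /n addn1. Qed.
Let inh : exists u v, test_pt n u v := test_pt_inhabited n.

Let n1 : (n %| 1 + 4 * M)%N.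
Proof. by rewrite /n add1n addn1 dvdnn. Qed.

Let n2 : (n %| 2 + 4 * (2 * M))%N.
Proof.
have -> : (2 + 4 * (2 * M) = 2 * n)%N by rewrite /n; lia.
exact: dvdn_mull.
Qed.

Let M2 : (M <= 2 * M)%N.
Proof. by rewrite leq_pmull. Qed.

(** [1 - u^(8(k+1))] may vanish at the point, so the recurrence is proved for the rational functions
    and transported by [loc_unique]. *)
Lemma poch_quot_rec u v k : test_pt n u v -> (k < M)%N ->
  poch_quot n (u ^+ 2) 1 M k.+1 * (1 - u ^+ 8 ^+ k.+1) =
  poch_quot n (u ^+ 2) 1 M k * (1 - u ^+ 2 * u ^+ 8 ^+ k).
Proof.
move=> p kM; have lX := @locX (test_pt n); have lq := loc_q (test_pt n).
have l1 := loc1 (test_pt n).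
have la : loc (test_pt n) (poch_quot n (qF ^+ 2) 1 M k.+1 * (1 - qF ^+ 8 ^+ k.+1))
    (fun u v => poch_quot n (u ^+ 2) 1 M k.+1 * (1 - u ^+ 8 ^+ k.+1)).
  apply: locM; first exact: loc_poch_quot.
  by apply: (locB inh) => //; apply: (lX); exact: lX.
have lb : loc (test_pt n) (poch_quot n (qF ^+ 2) 1 M k * (1 - qF ^+ 2 * qF ^+ 8 ^+ k))
    (fun u v => poch_quot n (u ^+ 2) 1 M k * (1 - u ^+ 2 * u ^+ 8 ^+ k)).
  apply: locM; first by apply: loc_poch_quot; apply: ltnW.
  by apply: (locB inh) => //; apply: locM; [exact: lX|apply: (lX); exact: lX].
suff e : poch_quot n (qF ^+ 2) 1 M k.+1 * (1 - qF ^+ 8 ^+ k.+1) =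
    poch_quot n (qF ^+ 2) 1 M k * (1 - qF ^+ 2 * qF ^+ 8 ^+ k).
  by rewrite e in la; exact: (loc_unique inh la lb p).
rewrite !qF_poch_quot //; last exact: ltnW.
have h j : 1 - qF ^+ 8 ^+ j.+1 != 0.
  have pt : test_pt n tF (tF ^+ (2 * n)) by right; split=> //; left.
  apply: (loc_neq0 (locB inh (loc1 _) (lX _ _ j.+1 (lX _ _ 8 lq))) pt).
  by rewrite -exprM tFX_neq1.
have hp : poch (qF ^+ 8 : {fraction Rqa}) (qF ^+ 8) k != 0.
  by apply: poch_neq0 => i _; rewrite -exprS h.
rewrite !pochS -exprS muln1.
by rewrite -mulrA [X in _ * X]mulrC invfM mulrA mulrACA mulfV ?h // mulr1 mulrAC.
Qed.

Lemma sum_pts u v : test_pt n u v ->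
  \sum_(k < M.+1) lhs_term u v (poch_quot n (u ^+ 2) 1 M k) k =
  rhs u v (poch_quot n (u ^+ 2) 2 (2 * M) M) M.
Proof.
move=> p; have u0 := pt_u_neq0 p.
case: (p) => [[w [uw vt w1 w2]]|[ut h]]; last first.
  subst u; rewrite (tF_poch_quot p n2 M2).
  rewrite (eq_bigr (fun k : 'I_M.+1 => lhs_term tF v
      (poch (tF ^+ 2) (tF ^+ 8) k / poch (tF ^+ 8) (tF ^+ 8) k) k)); last first.
    by move=> k _; rewrite (tF_poch_quot p n1) // -ltnS.
  have S := @sum_lhs_term Ft tF M u0 (fun j => @tFX_neq1 j.+1 isT).
  have e : (8 * M + 2 = 2 * n)%N by rewrite /n; lia.
  rewrite e in S; case: h => ->; first exact: S.
  rewrite rhsV -S; apply: eq_bigr => k _; exact: lhs_termV.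
have un : u ^+ (2 * n) = 1 by rewrite uw -rmorphXn w1 rmorph1.
(* The right-hand side contains [1 - u^(2n) = 0]. *)
rewrite /rhs -/n un subrr !mul0r.
rewrite -(big_mkord xpredT (fun k => lhs_term u v (poch_quot n (u ^+ 2) 1 M k) k)).
have wn : (w ^+ 2) ^+ n = 1 by rewrite -exprM.
have [d prim dn] := prim_order_exists n0 wn.
have d0 := prim_order_gt0 prim.
have uE i : (u ^+ i == 1) = (w ^+ i == 1).
  by rewrite uw -rmorphXn -(rmorph1 constF) (inj_eq (fmorph_inj constF)).
(* [d] divides the odd number [n], so [u^8], the fourth power of [u^2], still has order [d]. *)
have codd : coprime d 4.
  by rewrite (coprime_dvdl dn) // /n coprime_sym /coprime mulnC gcdnMDl.
have MdE : (d %| 4 * (M %% d) + 1)%N.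
  have : (d %| 4 * (M %/ d * d) + (4 * (M %% d) + 1))%N.
    by rewrite addnA -mulnDr -divn_eq.
  by rewrite dvdn_addr // mulnA dvdn_mull.
have uP i : (d %| i)%N -> u ^+ (2 * i) = 1.
  by move=> di; apply/eqP; rewrite uE exprM -(prim_order_dvd prim).
have char2 : (2 : Ft) != 0 by rewrite natF_eq0.
have zd : u ^+ 2 ^+ d = 1 by rewrite -exprM uP.
have zm : u ^+ 2 * u ^+ 8 ^+ (M %% d) = 1.
  rewrite -exprM -exprD -(uP _ MdE); congr (_ ^+ _).
  by rewrite mulnDr mulnA addnC.
have ZN1 k : (0 < k < d)%N -> 1 - u ^+ 8 ^+ k != 0.
  move=> /andP[k0 kd]; have e : (8 * k = 2 * (4 * k))%N by lia.
  rewrite subr_eq0 eq_sym -exprM uE e exprM.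
  by rewrite -(prim_order_dvd prim) Gauss_dvdr // gtnNdvd.
have Q := (@sum_lhs_term_root_of_unity _ u v d (M %% d) char2 (pt_u1 p)
  (pt_v_neq0 p) d0 zd zm ZN1 (pt_vk p) (fun k => pt_vVk k p)
  (ltn_pmod M d0) (poch_quot n (u ^+ 2) 1 M) M (M %/ d)).
apply: Q.
- by move=> k kM; apply: (poch_quot_rec p kM).
- exact: divn_eq.
Qed.

End Evaluation.

Lemma lhs_termE (F : fieldType) (u v : F) k :
  (1 - u ^+ (2 * (8 * k + 1))) / (1 - u ^+ 2) *
  ((1 - u ^+ (8 * k + 1)) / (1 - u)) ^+ 2 *
  (poch (u ^+ 2) (u ^+ 8) k ^+ 2 * poch (v * u ^+ 2) (u ^+ 8) k
     * poch (u ^+ 2 / v) (u ^+ 8) k)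
  / (poch (u ^+ 8) (u ^+ 8) k ^+ 2 * poch (v * u ^+ 8) (u ^+ 8) k
     * poch (u ^+ 8 / v) (u ^+ 8) k)
  * u ^- (4 * k) =
  lhs_term u v (poch (u ^+ 2) (u ^+ 8) k / poch (u ^+ 8) (u ^+ 8) k) k.
Proof.
rewrite /lhs_term expr_div_n !invfM; congr (_ * _).
by move: (_ / _) (_ ^+ 2) => X Y; ring.
Qed.

Theorem theorem4 (n : nat) (hn : (0 < n)%N) (hmod : (n %% 4 = 1)%N) :
  congr_mod
    (\sum_(0 <= k < ((n - 1) %/ 4).+1)
        qint2 (8 * k + 1) * qint (8 * k + 1) ^+ 2 *
        (qpoch (qF ^+ 2) (qF ^+ 8) k ^+ 2 * qpoch (aF * qF ^+ 2) (qF ^+ 8) k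
           * qpoch (qF ^+ 2 / aF) (qF ^+ 8) k)
        / (qpoch (qF ^+ 8) (qF ^+ 8) k ^+ 2 * qpoch (aF * qF ^+ 8) (qF ^+ 8) k
           * qpoch (qF ^+ 8 / aF) (qF ^+ 8) k)
        * qF ^- (4 * k))
    (qint2 n * (qpoch (qF ^+ 4) (qF ^+ 8) ((n - 1) %/ 4)
                / qpoch (qF ^+ 8) (qF ^+ 8) ((n - 1) %/ 4))
       * qF ^- ((n - 1) %/ 2)
       * (1 - (1 - aF * qF ^+ 2) * (1 - qF ^+ 2 / aF)
              / ((1 - qF) ^+ 2 * (1 + qF ^+ 2))))
    (qint2P n * (1 - aP * qP ^+ (2 * n)) * (aP - qP ^+ (2 * n))).
Proof.
have [M ->] : exists M, n = (4 * M + 1)%N by exists (n %/ 4)%N; lia.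
have -> : ((4 * M + 1 - 1) %/ 4 = M)%N by lia.
have -> : ((4 * M + 1 - 1) %/ 2 = 2 * M)%N by lia.
have n0 : (0 < 4 * M + 1)%N by lia.
apply: (loc0_congr_mod n0).
set n' := (4 * M + 1)%N.
have n1 : (n' %| 1 + 4 * M)%N by rewrite /n' add1n addn1 dvdnn.
have n2 : (n' %| 2 + 4 * (2 * M))%N.
  have -> : (2 + 4 * (2 * M) = 2 * n')%N by rewrite /n'; lia.
  exact: dvdn_mull.
have M2 : (M <= 2 * M)%N by lia.
have inh := test_pt_inhabited n'.
(* Both sides are rewritten with the pole-free coefficients [poch_quot], which makes them regular at
   the test points. *)
pose L : Kqa := \sum_(k < M.+1) lhs_term (qF : {fraction Rqa}) aF (poch_quot n' (qF ^+ 2) 1 M k) k.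
pose R : Kqa := rhs (qF : {fraction Rqa}) aF (poch_quot n' (qF ^+ 2) 2 (2 * M) M) M.
have LE : L = \sum_(0 <= k < M.+1)
    qint2 (8 * k + 1) * qint (8 * k + 1) ^+ 2 *
    (qpoch (qF ^+ 2) (qF ^+ 8) k ^+ 2 * qpoch (aF * qF ^+ 2) (qF ^+ 8) k
       * qpoch (qF ^+ 2 / aF) (qF ^+ 8) k)
    / (qpoch (qF ^+ 8) (qF ^+ 8) k ^+ 2 * qpoch (aF * qF ^+ 8) (qF ^+ 8) k
       * qpoch (qF ^+ 8 / aF) (qF ^+ 8) k)
    * qF ^- (4 * k).
  rewrite big_mkord; apply: eq_bigr => k _.
  rewrite (qF_poch_quot n1) -1?ltnS //.
  by rewrite -(@lhs_termE {fraction Rqa} qF aF k).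
have RE : R = qint2 (4 * M + 1) * (qpoch (qF ^+ 4) (qF ^+ 8) M / qpoch (qF ^+ 8) (qF ^+ 8) M)
       * qF ^- (2 * M)
       * (1 - (1 - aF * qF ^+ 2) * (1 - qF ^+ 2 / aF)
              / ((1 - qF) ^+ 2 * (1 + qF ^+ 2))).
  by rewrite /R (qF_poch_quot n2 M2).
rewrite -LE -RE.
apply: (@loc_ext _ _ (fun u v =>
  \sum_(k < M.+1) lhs_term u v (poch_quot n' (u ^+ 2) 1 M k) k -
  rhs u v (poch_quot n' (u ^+ 2) 2 (2 * M) M) M)).
  by move=> u v p; rewrite (sum_pts p) subrr.
apply: (locB inh).
  apply: (loc_sum inh (x := fun k => lhs_term (qF : {fraction Rqa}) aF (poch_quot n' (qF ^+ 2) 1 M k) k)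
    (f := fun k u v => lhs_term u v (poch_quot n' (u ^+ 2) 1 M k) k)) => k kM.
  by apply: loc_lhs_term; apply: loc_poch_quot.
by apply: loc_rhs; apply: loc_poch_quot.
Qed.
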